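(* Let $d\ge 1$, let $\Omega\subset\mathbb{R}^d$ be a bounded domain (nonempty connected open set), let $\varepsilon>0$, and let $\phi$ be either the MultiQuadric $\phi(r)=\sqrt{1+(\varepsilon r)^2}$ or the Inverse MultiQuadric $\phi(r)=1/\sqrt{1+(\varepsilon r)^2}$. Let $m\ge 1$ and let $Q_1,\dots,Q_m$ be any fixed set of $m$ distinct points of $\partial\Omega$. Let $P_1,P_2,\dots$ be a sequence of independent and identically distributed random points in $\Omega$ with respect to a probability density $\sigma\in L^1_+(\Omega)$. For $n\ge 0$, define $\phi_j(P)=\phi(\|P-P_j\|_2)$ for $1\le j\le n$ and $\psi_k(P)=\phi(\|P-Q_k\|_2)$ for $1\le k\le m$, and let $K_n$ be the $(n+m)\times(n+m)$ Kansa collocation matrix $$K_n=\begin{pmatrix}\Delta\Phi & \Delta\Psi\\ \Phi & \Psi\end{pmatrix},$$ where $\Delta\Phi=(\Delta\phi_j(P_i))_{1\le i,j\le n}$, $\Delta\Psi=(\Delta\psi_k(P_i))_{1\le i\le n,\,1\le k\le m}$, $\Phi=(\phi_j(Q_h))_{1\le h\le m,\,1\le j\le n}$, $\Psi=(\psi_k(Q_h))_{1\le h,k\le m}$, and $\Delta=\sum_{l=1}^d\partial^2/\partial x_l^2$ is the Laplacian. Then for every $m\ge1$ and every $n\ge 0$ the matrix $K_n$ is almost surely nonsingular.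
   Context: This is the matrix of unsymmetric Kansa collocation for the Dirichlet problem of the Poisson equation $\Delta u=f$ in $\Omega$, $u=g$ on $\partial\Omega$: one seeks $u_N=\sum_{j=1}^n c_j\phi_j+\sum_{k=1}^m d_k\psi_k$ with $\Delta u_N(P_i)=f(P_i)$, $i=1,\dots,n$, and $u_N(Q_h)=g(Q_h)$, $h=1,\dots,m$. For $n=0$ the matrix $K_0$ is just $\Psi$. ''Almost surely'' refers to the joint distribution of the i.i.d. random points $P_1,\dots,P_n$ with density $\sigma$ (a nonnegative integrable function on $\Omega$ with integral 1). *)

(* Defs.v *)
From HB Require Import structures.
From mathcomp Require Import all_boot all_order all_algebra.
From mathcomp Require Import all_classical all_reals all_analysis.
Set Implicit Arguments. Unset Strict Implicit. Unset Printing Implicit Defensive.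
Import Order.TTheory GRing.Theory Num.Theory.
Import numFieldNormedType.Exports.
Local Open Scope classical_set_scope.
Local Open Scope ring_scope.

(* ---------- Points of R^d : row vectors 'rV[R]_d ----------
   The topology (open, connected, closure, bounded_set) is the library one
   on matrices (product topology = Euclidean topology).                     *)

(* Borel (= product) sigma-algebra on 'rV[R]_d, generated by the coordinates,
   exactly as the library does for n.-tuple T. *)
Section measurable_rV.
Context (R : realType) (n : nat).
Let coor : 'I_n -> 'rV[R]_n -> R := fun i x => x ord0 i.
Let rV_set0 : g_sigma_preimage coor set0.
Proof. exact: sigma_algebra0. Qed.
Let rV_setC A : g_sigma_preimage coor A -> g_sigma_preimage coor (~` A).
Proof. exact: sigma_algebraC. Qed.
Let rV_bigcup (F : _^nat) : (forall i, g_sigma_preimage coor (F i)) ->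
  g_sigma_preimage coor (\bigcup_i (F i)).
Proof. exact: sigma_algebra_bigcup. Qed.
HB.instance Definition _ := @isMeasurable.Build
  (measure_tuple_display default_measure_display)
  'rV[R]_n (g_sigma_preimage coor) rV_set0 rV_setC rV_bigcup.
End measurable_rV.

Definition rV_cons (R : realType) (k : nat) (p : R * 'rV[R]_k) : 'rV[R]_k.+1 :=
  \row_(i < k.+1) (if unlift ord0 i is Some j then p.2 ord0 j else p.1).

Fixpoint lebesgue_rV (R : realType) (k : nat) : set 'rV[R]_k -> \bar R :=
  match k with
  | 0 => fun A => dirac (0 : 'rV[R]_0) A
  | k'.+1 => fun A =>
      ((lebesgue_measure : set R -> \bar R) \x (@lebesgue_rV R k'))%E
        (@rV_cons R k' @^-1` A)
  end.

Definition enorm (R : realType) (d : nat) (x : 'rV[R]_d) : R :=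
  Num.sqrt (\sum_(l < d) x ord0 l ^+ 2).

Inductive rbf_kind := MultiQuadric | InverseMultiQuadric.

Definition rbf (R : realType) (k : rbf_kind) (eps r : R) : R :=
  match k with
  | MultiQuadric => Num.sqrt (1 + (eps * r) ^+ 2)
  | InverseMultiQuadric => (Num.sqrt (1 + (eps * r) ^+ 2))^-1
  end.

Definition ebasis (R : realType) (d : nat) (l : 'I_d) : 'rV[R]_d :=
  delta_mx ord0 l.

Definition laplacian (R : realType) (d : nat) (f : 'rV[R]_d -> R)
    (x : 'rV[R]_d) : R :=
  \sum_(l < d) 'D_(ebasis R l) ('D_(ebasis R l) f) x.

Definition rbf_at (R : realType) (d : nat) (k : rbf_kind) (eps : R)
    (c : 'rV[R]_d) : 'rV[R]_d -> R :=
  fun P => rbf k eps (enorm (P - c)).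

Definition kansa_matrix (R : realType) (d : nat) (k : rbf_kind) (eps : R)
    (n m : nat) (P : 'I_n -> 'rV[R]_d) (Q : 'I_m -> 'rV[R]_d) : 'M[R]_(n + m) :=
  block_mx
    (\matrix_(i < n, j < n) laplacian (rbf_at k eps (P j)) (P i))
    (\matrix_(i < n, kk < m) laplacian (rbf_at k eps (Q kk)) (P i))
    (\matrix_(h < m, j < n) rbf_at k eps (P j) (Q h))
    (\matrix_(h < m, kk < m) rbf_at k eps (Q kk) (Q h)).

Definition boundary_of (R : realType) (d : nat) (O : set 'rV[R]_d) :=
  closure O `\` interior O.

Definition density_law (R : realType) (d : nat) (O : set 'rV[R]_d)
    (sigma : 'rV[R]_d -> R) : set 'rV[R]_d -> \bar R :=
  fun A => (\int[@lebesgue_rV R d]_(x in A `&` O) (sigma x)%:E)%E.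

Fixpoint iid_law (R : realType) (d : nat) (mu : set 'rV[R]_d -> \bar R)
    (n : nat) : set (n.-tuple 'rV[R]_d) -> \bar R :=
  match n with
  | 0 => fun A => dirac ([tuple] : 0.-tuple 'rV[R]_d) A
  | n'.+1 => fun A =>
      (mu \x (@iid_law R d mu n'))%E
        ((fun p : 'rV[R]_d * n'.-tuple 'rV[R]_d => [tuple of p.1 :: p.2]) @^-1` A)
  end.

(* Main.v *)
Require Import Defs.
From HB Require Import structures.
From mathcomp Require Import all_boot all_order all_algebra fingroup perm.
From mathcomp Require Import all_classical all_reals all_analysis.
From mathcomp Require Import measurable_realfun ring lra.
Import Order.TTheory GRing.Theory Num.Theory.
Import numFieldNormedType.Exports HBNNSimple.
Local Open Scope classical_set_scope.
Local Open Scope ring_scope.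
Set Implicit Arguments. Unset Strict Implicit. Unset Printing Implicit Defensive.

(* The points are added one at a time. The matrix of the Q's alone is
   nonsingular by Micchelli's theorem. If K is the (nonsingular) matrix of the
   centres X_a chosen so far, the Schur complement shows that adding x keeps it
   nonsingular iff
     G(x) = alpha - sum_{a,b} (K^-1)_{ab} R_a(x) C_b(x) <> 0,
   where, with s_a(x) = 1 + eps^2 |x - X_a|^2, both R_a and C_a are sqrt(s_a)
   times rational functions of s_a, and alpha <> 0 is the Laplacian of phi at
   the origin. On a line every s_a is a polynomial. Dividing by one of the
   square roots and differentiating repeatedly (Rolle) shows that a combination
   of square roots of polynomials with polynomial coefficients either vanishes
   identically or has finitely many zeros; hence, by Fubini, the zero set of G
   is null unless G = 0. On a generic line through the origin the s_a are
   pairwise coprime irreducible quadratics, so sqrt(s_a s_b) (a <> b) is not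
   rational and G = 0 forces its diagonal part
   alpha - sum_a (K^-1)_{aa} R_a C_a to vanish; this is a rational function
   with poles at the zeros of the s_a, so all (K^-1)_{aa} vanish, and then
   alpha = 0, a contradiction. *)

(** * Zeros of sums of square roots of polynomials *)

(** By Rolle, if the zeros of [df] were finitely many, listed in [s], the number of them below [x]
    would increase strictly along the zeros of [f] and embed these into a finite set. *)
Lemma infinite_zeros_derive (R : realType) (f df : R -> R) :
  (forall x, is_derive x (1 : R) f (df x)) ->
  infinite_set [set x | f x = 0] -> infinite_set [set x | df x = 0].
Proof.
move=> fdf inff /finite_seqP[s sE]; apply: inff.
have sP x : df x = 0 <-> x \in s.
  by have /= -> : [set x | df x = 0] x = [set` s] x by rewrite sE.
(* Off the zeros of [f] the default [(size s).+1] exceeds every possible count, so the preimage of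
   the range of counts is exactly the zero set. *)
pose c x := if `[< f x = 0 >] then count (fun y => y < x) s else (size s).+1.
have cE x : f x = 0 -> c x = count (fun y => y < x) s.
  by move=> fx; rewrite /c; case: asboolP.
have -> : [set x | f x = 0] = c @^-1` `I_(size s).+1.
  apply/seteqP; split => x /=.
    by move=> fx; rewrite cE // ltnS count_size.
  by rewrite /c; case: asboolP => //; rewrite ltnn.
apply: finite_preimage; last exact: finite_II.
have lt_count x y : f x = 0 -> f y = 0 -> x < y -> (c x < c y)%N.
  move=> fx fy xy; rewrite !cE //.
  have [z zxy dz] : exists2 z, z \in `]x, y[ & is_derive z (1 : R) f 0.
    apply: Rolle => //; last by rewrite fx fy.
    apply: derivable_within_continuous => z _; exact: ex_derive.
  have zs : z \in s.
    by apply/sP; rewrite -(@derive_val _ _ _ _ _ _ _ (fdf z)) derive_val.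
  move: zxy; rewrite in_itv /= => /andP[xz zy].
  have -> : count (fun t => t < y) s =
      (count (fun t => t < x)%R s + count (fun t => x <= t < y)%R s)%N.
    elim: (s) => //= t s' ->; rewrite addnACA; congr addn.
    by have [tx|xt] := ltP t x; rewrite /= ?(lt_trans tx xy).
  rewrite -[ltnLHS]addn0 ltn_add2l -has_count; apply/hasP; exists z => //=.
  by rewrite ltW.
have fP x : x \in c @^-1` `I_(size s).+1 -> f x = 0.
  by rewrite inE /= /c; case: asboolP => //; rewrite ltnn.
move=> x y /fP fx /fP fy cxy.
have [xy|yx|//] := ltgtP x y.
- by have := lt_count _ _ fx fy xy; rewrite cxy ltnn.
- by have := lt_count _ _ fy fx yx; rewrite cxy ltnn.
Qed.

Lemma infinite_roots_eq0 (R : realType) (p : {poly R}) :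
  infinite_set [set x | p.[x] = 0] -> p = 0.
Proof.
move=> /(infinite_set_fset (size p))[B Bp sB].
apply/eqP; apply: contraLR sB => p0; rewrite -ltnNge.
apply: max_poly_roots => //; last exact: finmap.fset_uniq.
by apply/allP => x xB; apply/rootP; exact: Bp.
Qed.

(** Positive functions with logarithmic derivative [r / Q]. Sharing one denominator [Q] lets all
    terms of a sum keep the same shape under differentiation. *)
Definition log_rational (R : realType) (Q : {poly R}) (y : R -> R) :=
  (forall x, 0 < y x) /\
  exists r : {poly R}, forall x, is_derive x (1 : R) y (r.[x] / Q.[x] * y x).

(** For positive functions: [y0 / y] is not a rational function, stated without division. *)
Definition poly_indep (R : realType) (y0 y : R -> R) :=
  forall p r : {poly R}, (forall x, p.[x] * y0 x = r.[x] * y x) -> p = 0.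

Lemma is_derive_eqfun (R : realType) (f g : R -> R) (x a b : R) :
  is_derive x (1 : R) f a -> f =1 g -> a = b -> is_derive x (1 : R) g b.
Proof. by move=> + /funext <- <-. Qed.

Lemma is_derive_sum_seq (R : realType) (I : eqType) (l : seq I)
    (f df : I -> R -> R) (x : R) :
  (forall i, i \in l -> is_derive x (1 : R) (f i) (df i x)) ->
  is_derive x (1 : R) (fun x => \sum_(i <- l) f i x) (\sum_(i <- l) df i x).
Proof.
elim: l => [|i l IH] fdf.
  apply: (is_derive_eqfun (is_derive_cst (0 : R) x (1 : R))) => [t|].
    by rewrite big_nil.
  by rewrite big_nil.
have H1 := fdf i (mem_head _ _).
have H2 := IH (fun j jl => fdf j (mem_behead (s := i :: l) jl)).
apply: (is_derive_eqfun (is_deriveD H1 H2)) => [t|]; by rewrite big_cons.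
Qed.

Section log_rational_theory.
Context (R : realType) (Q : {poly R}).
Hypothesis Q_gt0 : forall x, 0 < Q.[x].

Let Qneq0 x : Q.[x] != 0. Proof. by rewrite gt_eqF. Qed.

Lemma log_rational1 : log_rational Q (fun=> 1).
Proof.
split=> [//|]; exists 0 => x.
by apply: (is_derive_eqfun (is_derive_cst (1 : R) x (1 : R))) => //;
  rewrite horner0 !mul0r.
Qed.

Lemma log_rationalM y z :
  log_rational Q y -> log_rational Q z -> log_rational Q (fun x => y x * z x).
Proof.
move=> [y0 [r yr]] [z0 [s zs]]; split=> [x|]; first by rewrite mulr_gt0.
exists (r + s) => x.
apply: (is_derive_eqfun (is_deriveM (yr x) (zs x))) => //.
by rewrite hornerD /GRing.scale /=; field.
Qed.

Lemma log_rationalV y :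
  log_rational Q y -> log_rational Q (fun x => (y x)^-1).
Proof.
move=> [y0 [r yr]]; split=> [x|]; first by rewrite invr_gt0.
exists (- r) => x.
have yn0 : y x != 0 by rewrite gt_eqF.
apply: (is_derive_eqfun (is_deriveV yn0 (yr x))) => //.
by rewrite hornerN /GRing.scale /=; field; rewrite yn0 Qneq0.
Qed.

Lemma log_rationalQ : log_rational Q (fun x => Q.[x]).
Proof.
split=> [//|]; exists Q^`() => x.
by apply: (is_derive_eqfun (is_derive_poly Q x)) => //; rewrite divfK.
Qed.

(** [(sqrt q)' = q' / (2 q) * sqrt q], and the cofactor [c] brings the denominator [q] to [Q]. *)
Lemma log_rational_sqrt (q c : {poly R}) : q * c = Q -> (forall x, 0 < q.[x]) ->
  log_rational Q (fun x => Num.sqrt q.[x]).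
Proof.
move=> qc q0; split=> [x|]; first by rewrite sqrtr_gt0.
exists (2^-1 *: (q^`() * c)) => x.
have sq0 : Num.sqrt q.[x] != 0 by rewrite gt_eqF // sqrtr_gt0.
have qE : q.[x] = Num.sqrt q.[x] ^+ 2 by rewrite sqr_sqrtr // ltW.
apply: (is_derive_eqfun
  (is_derive1_comp (is_derive1_sqrt (q0 x)) (is_derive_poly q x))) => //.
have c0 : c.[x] != 0.
  by apply: contraTneq (Qneq0 x) => c0; rewrite -qc hornerM c0 mulr0 eqxx.
rewrite -qc hornerZ !hornerM.
by move: (Num.sqrt q.[x]) sq0 qE => w w0 ->; field; rewrite c0 w0.
Qed.

Lemma is_derive_pM (p r : {poly R}) y x :
  is_derive x (1 : R) y (r.[x] / Q.[x] * y x) ->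
  is_derive x (1 : R) (fun x => p.[x] * y x)
    ((p^`() * Q + p * r).[x] * (y x / Q.[x])).
Proof.
move=> yr; apply: (is_derive_eqfun (is_deriveM (is_derive_poly p x) yr)) => //.
by rewrite hornerD !hornerM /GRing.scale /=; field.
Qed.

End log_rational_theory.

Lemma const_of_derive0 (R : realType) (f : R -> R) :
  (forall x, is_derive x (1 : R) f 0) -> forall x, f x = f 0.
Proof. by move=> f0 x; apply: is_derive_0_is_cst. Qed.

(** The term [p0 * y0] is kept apart because its coefficient is the one that independence will force
    to vanish. *)
Definition quasi_sum (R : realType) (I : eqType) (l : seq I)
    (p0 : {poly R}) (y0 : R -> R) (p : I -> {poly R}) (y : I -> R -> R) x :=
  p0.[x] * y0 x + \sum_(i <- l) (p i).[x] * y i x.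

(** Induction on the number of terms: division by [y j] turns one term into a polynomial, and
    repeated differentiation, which preserves having infinitely many zeros, removes it. Both
    conclusions are then pulled back through the derivatives. With no term left, [p0] itself has
    infinitely many roots. *)
Lemma quasi_sum_zeros (R : realType) (Q : {poly R}) (I : eqType) (l : seq I)
    (p0 : {poly R}) (y0 : R -> R) (p : I -> {poly R}) (y : I -> R -> R) :
  (forall x, 0 < Q.[x]) ->
  log_rational Q y0 -> (forall i, i \in l -> log_rational Q (y i)) ->
  infinite_set [set x | quasi_sum l p0 y0 p y x = 0] ->
  (forall x, quasi_sum l p0 y0 p y x = 0) /\
  ((forall i, i \in l -> poly_indep y0 (y i)) -> p0 = 0).
Proof.
move=> Q0; have Qn0 x : Q.[x] != 0 by rewrite gt_eqF.
elim: l => [|j l IH] in p0 y0 p y * => lr0 lr inf.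
  have p00 : p0 = 0.
    apply: infinite_roots_eq0; apply: sub_infinite_set inf => x /=.
    rewrite /quasi_sum big_nil addr0 => /eqP; rewrite mulf_eq0.
    by rewrite (gt_eqF (lr0.1 x)) orbF => /eqP.
  split=> [x|//]; by rewrite /quasi_sum big_nil p00 horner0 mul0r addr0.
(* With [y j] normalised to 1, each differentiation lowers the degree of its
   coefficient until the term disappears. *)
have inner : forall n (P : {poly R}) p0 y0 p (y : I -> R -> R),
    (size P <= n)%N -> log_rational Q y0 ->
    (forall i, i \in l -> log_rational Q (y i)) ->
    infinite_set [set x | P.[x] + quasi_sum l p0 y0 p y x = 0] ->
    (forall x, P.[x] + quasi_sum l p0 y0 p y x = 0) /\
    (poly_indep y0 (fun=> 1) ->
     (forall i, i \in l -> poly_indep y0 (y i)) -> p0 = 0).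
  clear p0 y0 p y lr0 lr inf.
  elim=> [|n IHn] P p0 y0 p y sP lr0 lr inf.
    move: sP; rewrite size_poly_leq0 => /eqP P0; rewrite P0 in inf *.
    have [|h1 h2] := IH p0 y0 p y lr0 lr.
      by apply: sub_infinite_set inf => x /=; rewrite horner0 add0r.
    by split=> [x|_ //]; rewrite horner0 add0r.
  have [y0pos [r0 y0r]] := lr0.
  have /choice[r yr] : forall i, exists r : {poly R}, i \in l ->
      forall x, is_derive x (1 : R) (y i) (r.[x] / Q.[x] * y i x).
    move=> i; case: (boolP (i \in l)) => il; last by exists 0.
    by have [_ [r yr]] := lr i il; exists r.
  pose p0' := p0^`() * Q + p0 * r0.
  pose p' i := (p i)^`() * Q + p i * r i.
  have dh x : is_derive x (1 : R) (fun x => P.[x] + quasi_sum l p0 y0 p y x)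
      (P^`().[x] + quasi_sum l p0' (fun x => y0 x / Q.[x]) p'
                      (fun i x => y i x / Q.[x]) x).
    have D0 := is_derive_pM Q0 p0 (y0r x).
    have Ds := @is_derive_sum_seq R I l (fun i x => (p i).[x] * y i x)
      (fun i x => (p' i).[x] * (y i x / Q.[x])) x
      (fun i il => is_derive_pM Q0 (p i) (yr i il x)).
    exact: is_deriveD (is_derive_poly P x) (is_deriveD D0 Ds).
  have inf' := infinite_zeros_derive dh inf.
  have lrQ z : log_rational Q z -> log_rational Q (fun x => z x / Q.[x]).
    move=> lrz; apply: log_rationalM => //.
    by apply: log_rationalV => //; exact: log_rationalQ.
  have [|h1 h2] := IHn _ _ _ _ _ _ (lrQ _ lr0) (fun i il => lrQ _ (lr i il)) inf'.
    have [->|P0] := eqVneq P 0; first by rewrite deriv0 size_poly0.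
    by rewrite -ltnS (leq_trans _ sP) // lt_size_deriv.
  have indepQ z1 z : poly_indep z1 z ->
      poly_indep (fun x => z1 x / Q.[x]) (fun x => z x / Q.[x]).
    move=> ind a b ab; apply: (ind a b) => x.
    by apply: (mulIf (invr_neq0 (Qn0 x))); rewrite -!mulrA ab.
  split.
    (* The derivative vanishes identically, so the sum is constant; since it has zeros, the constant
       is 0. *)
    have cst x : P.[x] + quasi_sum l p0 y0 p y x =
                 P.[0] + quasi_sum l p0 y0 p y 0.
      apply: (@const_of_derive0 _ (fun x => P.[x] + quasi_sum l p0 y0 p y x)).
      by move=> t; have := dh t; rewrite h1.
    move=> x; rewrite cst.
    apply: contrapT => /eqP n0; apply: inf.
    rewrite (_ : [set x | _] = set0); first exact: finite_set0.
    by apply/seteqP; split=> // t /=; rewrite cst => /eqP; rewrite (negbTE n0).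
  (* [p0' = 0] makes [p0 * y0] constant, that is, a polynomial multiple of 1; independence from 1
     then gives [p0 = 0]. *)
  move=> ind1 ind; have {h2} p0'0 : p0' = 0.
    apply: h2 => [|i il]; last exact/indepQ/ind.
    move=> a b ab; apply: (ind1 a (b * Q)) => x.
    by rewrite mulr1 hornerM -(mulr1 b.[x]) -ab mulrA divfK.
  apply: (ind1 p0 (p0.[0] * y0 0)%:P) => x; rewrite hornerC mulr1.
  apply: (@const_of_derive0 _ (fun x => p0.[x] * y0 x)) => t.
  by have := is_derive_pM Q0 p0 (y0r t); rewrite -/p0' p0'0 horner0 mul0r.
have jl : j \in j :: l by rewrite mem_head.
have lrj := lr j jl; have yj0 x : y j x != 0 by rewrite gt_eqF // (lrj.1 x).
have lrd z : log_rational Q z -> log_rational Q (fun x => z x / y j x).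
  by move=> lrz; apply: log_rationalM => //; exact: log_rationalV.
have lr' i : i \in l -> log_rational Q (fun x => y i x / y j x).
  by move=> il; apply/lrd/lr; rewrite inE il orbT.
have E x : quasi_sum (j :: l) p0 y0 p y x = y j x * ((p j).[x] +
    quasi_sum l p0 (fun x => y0 x / y j x) p (fun i x => y i x / y j x) x).
  rewrite /quasi_sum big_cons !mulrDr addrCA mulrC; congr (_ + (_ + _)).
    by field.
  by rewrite mulr_sumr; apply: eq_bigr => i _; field.
have [|h1 h2] := inner (size (p j)) (p j) p0 _ p _ (leqnn _) (lrd _ lr0) lr'.
  apply: sub_infinite_set inf => x /=; rewrite E => /eqP.
  by rewrite mulf_eq0 (negbTE (yj0 x)) => /eqP.
split=> [x|ind]; first by rewrite E h1 mulr0.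
apply: h2 => [a b ab|i il a b ab].
  apply: (ind j jl a b) => x; rewrite -[RHS]mulr1 -mulrA [_ * 1]mulrC mulrA.
  by rewrite mulr1 -[b.[x]]mulr1 -ab; field.
apply: (ind i _ a b) => [|x]; first by rewrite inE il orbT.
by apply: (mulIf (invr_neq0 (yj0 x))); rewrite -!mulrA ab.
Qed.

(** * Null sets *)

(* Stated for arbitrary set functions, since [lebesgue_rV], [density_law] and
   [iid_law] are not a priori measures. *)
Definition null_for d (T : measurableType d) (R : realType)
    (mu : set T -> \bar R) (N : set T) :=
  forall B, measurable B -> B `<=` N -> mu B = 0%E.

(** This uses only the definition of the integral as a supremum over simple functions: a nonnegative
    simple function below the positive or negative part of [f] on [D] has all its nonzero level sets
    inside [N]. *)
Lemma integral_off_null d (T : measurableType d) (R : realType)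
    (mu : set T -> \bar R) (N D : set T) (f : T -> \bar R) :
  null_for mu N -> (forall x, D x -> ~ N x -> f x = 0%E) ->
  (\int[mu]_(x in D) f x = 0)%E.
Proof.
move=> nullN f0; pose g := (f \_ D)%E.
have g0 x : ~ N x -> g x = 0%E.
  by move=> Nx; rewrite /g patchE; case: ifPn => // xD; apply: f0 => //; exact: set_mem.
have nn (k : T -> \bar R) : (forall x, ~ N x -> k x = 0%E) ->
    (forall x, (0 <= k x)%E) ->
    ereal_sup [set sintegral mu h |
      h in [set h : {nnsfun T >-> R} | forall x : T, ((h x)%:E <= k x)%E]] = 0%E.
  move=> k0 kge0.
  have sint (h : {nnsfun T >-> R}) : (forall x : T, ((h x)%:E <= k x)%E) ->
      sintegral mu h = 0%E.
    move=> hk; rewrite sintegralET; apply: fsbig1 => r _.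
    have [->|r0] := eqVneq r 0; first by rewrite mul0e.
    rewrite (nullN (h @^-1` [set r])) ?mule0 // => x /= hx.
    apply: contrapT => Nx; move/negP: r0; apply; rewrite -hx.
    by rewrite eq_le fun_ge0 andbT -lee_fin (le_trans (hk x)) // k0.
  apply/eqP; rewrite eq_le; apply/andP; split.
    by apply/ge_ereal_sup => _ [h /= hk <-]; rewrite sint.
  apply: ereal_sup_ubound; exists (@nnsfun0 _ T R); first exact: kge0.
  by apply: sint; exact: kge0.
rewrite /integral -/g !nn ?sube0 // => x Nx.
  by rewrite funenegE g0 // oppe0 maxxx.
by rewrite funeposE g0 // maxxx.
Qed.

Lemma null_for_negligible d (T : measurableType d) (R : realType)
    (mu : set T -> \bar R) (N : set T) :
  measurable N -> null_for mu N -> negligible mu N.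
Proof. by move=> mN nullN; exists N; split => //; exact: nullN. Qed.

(** * Measurability and Lebesgue null sets for row vectors *)

Lemma measurable_rV_coord (R : realType) k (i : 'I_k) :
  measurable_fun [set: 'rV[R]_k] (fun x => x ord0 i).
Proof.
move=> _ Y mY; rewrite setTI; apply: sub_sigma_algebra => /=.
rewrite -bigcup_seq/=; exists i => /=; first by rewrite mem_index_enum.
by exists Y => //; rewrite setTI.
Qed.

Lemma measurable_fun_rV d (T : measurableType d) (R : realType) k
    (f : T -> 'rV[R]_k) :
  (forall i, measurable_fun setT (fun t => f t ord0 i)) ->
  measurable_fun setT f.
Proof.
move=> mf.
have : g_sigma_preimage (fun (i : 'I_k) t => f t ord0 i) `<=` @measurable _ T.
  apply: smallest_sub; first exact: sigma_algebra_measurable.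
  rewrite -bigcup_seq/=; apply: bigcup_sub => i Ii.
  by move=> A [B mB <-]; exact: mf.
have -> : g_sigma_preimage (fun (i : 'I_k) t => f t ord0 i) =
    preimage_set_system setT f
      (g_sigma_preimage (fun (i : 'I_k) (x : 'rV[R]_k) => x ord0 i)).
  exact: (g_sigma_preimage_comp (fun (i : 'I_k) (x : 'rV[R]_k) => x ord0 i)).
by move=> sub _ Y mY; apply: sub; exists Y.
Qed.

Lemma measurable_rV_cons (R : realType) k (x0 : R) :
  measurable_fun setT (fun y : 'rV[R]_k => rV_cons (x0, y)).
Proof.
apply: measurable_fun_rV => i; rewrite /rV_cons.
under eq_fun do rewrite mxE.
case: unliftP => [j _|_] /=; first exact: measurable_rV_coord.
exact: measurable_cst.
Qed.

Lemma rV_cons_line (R : realType) k (x0 y0 t : R) (x y : 'rV[R]_k) :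
  rV_cons (x0 + t * y0, x + t *: y) = rV_cons (x0, x) + t *: rV_cons (y0, y).
Proof. by apply/rowP => i; rewrite !mxE; case: unliftP => [j _|_]; rewrite ?mxE. Qed.

Lemma rV_cons_eta (R : realType) k (x : 'rV[R]_k.+1) :
  x = rV_cons (x ord0 ord0, \row_j x ord0 (lift ord0 j)).
Proof. by apply/rowP => i; rewrite !mxE; case: unliftP => [j ->|->]; rewrite ?mxE. Qed.

(** A substitute for analyticity that passes to slices, as an induction on the dimension by Fubini
    requires. *)
Definition line_dichotomic (R : realType) k (G : 'rV[R]_k -> R) :=
  forall x v : 'rV[R]_k, infinite_set [set t | G (x + t *: v) = 0] ->
  forall t, G (x + t *: v) = 0.

(** Fubini and induction on the dimension: outside finitely many values of the first coordinate, the
    slice is again dichotomic and is nonzero at the tail of [p]. In dimension 0 the measure is the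
    Dirac mass at the only point. *)
Lemma line_dichotomic_null (R : realType) k (G : 'rV[R]_k -> R) p :
  line_dichotomic G -> G p != 0 ->
  null_for (@lebesgue_rV R k) [set x | G x = 0].
Proof.
elim: k => [|k IH] in G p *; move=> dG Gp B mB BG.
  rewrite /= diracE memNset // => /BG /= G0; move: Gp.
  by rewrite (_ : p = 0) ?G0 ?eqxx //; apply/rowP => -[].
rewrite [LHS]/= /product_measure1.
pose p' := \row_j p ord0 (lift ord0 j).
(* The line through [p] along the first axis; as [G p != 0], it carries finitely many zeros. *)
pose N := [set x0 | G (rV_cons (x0, p')) = 0].
have lineE t : rV_cons (t, p') = rV_cons (0, p') + t *: rV_cons (1, 0).
  by rewrite -rV_cons_line mulr1 add0r scaler0 addr0.
have finN : finite_set N.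
  apply: contrapT => infN; move/eqP: Gp; apply.
  rewrite (rV_cons_eta p) lineE; apply: dG; apply: sub_infinite_set infN.
  by move=> t; rewrite /N /= lineE.
apply: (@integral_off_null _ _ _ _ N).
  move=> C mC CN; apply: countable_lebesgue_measure0.
  by apply: finite_set_countable; exact: sub_finite_set CN finN.
move=> x0 _ /eqP Nx0 /=.
apply: (IH (fun y => G (rV_cons (x0, y))) p') => //.
- move=> x v inf t.
  have E s : rV_cons (x0, x + s *: v) = rV_cons (x0, x) + s *: rV_cons (0, v).
    by rewrite -rV_cons_line mulr0 addr0.
  rewrite E; apply: dG; apply: sub_infinite_set inf => s /=.
  by rewrite E.
- rewrite (_ : xsection _ _ = (fun y => rV_cons (x0, y)) @^-1` B).
    by rewrite -[X in measurable X]setTI; apply: measurable_rV_cons.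
  by apply/seteqP; split => y; rewrite /xsection /= inE.
- by move=> y; rewrite /xsection /= inE => /BG.
Qed.

Lemma density_law_null (R : realType) d (O : set 'rV[R]_d) sigma N :
  null_for (@lebesgue_rV R d) N -> null_for (density_law O sigma) N.
Proof.
move=> nullN B mB BN; rewrite /density_law.
by apply: (integral_off_null nullN) => x [Bx _] /(_ (BN _ Bx)).
Qed.

Lemma iid_law_null_cons (R : realType) d (mu : set 'rV[R]_d -> \bar R) n
    (N : set 'rV[R]_d) (S : set (n.+1.-tuple 'rV[R]_d)) :
  null_for mu N ->
  (forall x, ~ N x -> null_for (@iid_law R d mu n)
                       [set t : n.-tuple 'rV[R]_d | S [tuple of x :: t]]) ->
  null_for (@iid_law R d mu n.+1) S.
Proof.
move=> nullN nullS B mB BS; rewrite /= /product_measure1.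
apply: (integral_off_null nullN) => x _ Nx /=.
apply: (nullS x Nx).
  rewrite (_ : xsection _ _ =
    (fun t : n.-tuple 'rV[R]_d => [the n.+1.-tuple _ of x :: t]) @^-1` B).
    rewrite -[X in measurable X]setTI; exact: measurable_cons.
  by apply/seteqP; split => y; rewrite /xsection /= inE.
by move=> t; rewrite /xsection /= inE => /BS.
Qed.

(** * Kernel sums on a line and in several variables *)

(** Modulo [s], the composite is congruent to the nonzero constant [w.[0]]. *)
Lemma coprime_comp_poly (F : fieldType) (w s : {poly F}) :
  w.[0] != 0 -> coprimep s (w \Po s).
Proof.
move=> w0.
have [q wE] : exists q, w = q * 'X + (w.[0])%:P.
  have /factor_theorem[q qE] : root (w - (w.[0])%:P) 0.
    by rewrite /root !hornerE subrr.
  by exists q; move: qE; rewrite subr0 => <-; rewrite subrK.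
rewrite wE comp_polyD comp_polyM comp_polyX comp_polyC.
by rewrite coprimep_addl_mul -alg_polyC coprimep_sym coprimepZl ?coprime1p.
Qed.

(** Infinite descent: [s] divides [p], hence [r ^+ 2 * b], hence [r]; cancelling [s ^+ 2] leaves a
    solution of smaller size. Thus the square root of [s * b] is not rational. *)
Lemma sqr_irreducible_neq (F : fieldType) (s b p r : {poly F}) :
  irreducible_poly s -> coprimep s b -> p ^+ 2 = r ^+ 2 * (s * b) -> p = 0.
Proof.
move=> irr cop; have s0 := irredp_neq0 irr; have [ss _] := irr.
have dvd2 q : s %| q ^+ 2 -> s %| q.
  move=> sq; apply: contraLR sq; rewrite -!irreducible_poly_coprime //.
  exact: coprimep_expr.
have [n] := ubnP (size p); elim: n => // n IH in p r * => /ltnSE sp pE.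
have /dvdpP[p1 p1E] : s %| p.
  by apply: dvd2; rewrite pE mulrCA dvdp_mulr.
have E1 : s * p1 ^+ 2 = r ^+ 2 * b.
  apply: (mulfI s0); rewrite [RHS]mulrCA -pE p1E; ring.
have /dvdpP[r1 r1E] : s %| r.
  by apply: dvd2; rewrite -(Gauss_dvdpl _ cop) -E1 dvdp_mulr.
have E2 : p1 ^+ 2 = r1 ^+ 2 * (s * b).
  apply: (mulfI s0); rewrite E1 r1E; ring.
have [p10|p10] := eqVneq p1 0; first by rewrite p1E p10 mul0r.
have /eqP : p1 = 0; last by rewrite (negbTE p10).
apply: IH E2; apply: leq_trans sp; rewrite p1E size_mul //.
by rewrite -subn1 -addnBA ?(ltnW ss) // -[X in (X < _)%N]addn0 ltn_add2l subn_gt0.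
Qed.

Lemma infinite_setT_real (R : realType) : infinite_set [set: R].
Proof.
move=> finR; apply: infinite_nat.
apply: (@finite_preimage _ _ [set: R] (fun n : nat => n%:R)) => //.
by move=> x y _ _ /eqP; rewrite eqr_nat => /eqP.
Qed.

Lemma poly_eq_horner (R : realType) (p q : {poly R}) :
  (forall x, p.[x] = q.[x]) -> p = q.
Proof.
move=> pq; apply/eqP; rewrite -subr_eq0; apply/eqP/infinite_roots_eq0.
rewrite (_ : [set x | _] = setT); first exact: infinite_setT_real.
by apply/seteqP; split => // x _ /=; rewrite !hornerE pq subrr.
Qed.

Section kernel_sums.
Context (R : realType) (I : finType) (s u v : I -> {poly R}).
Context (alpha : R) (beta : I -> I -> R).
Hypothesis s_gt0 : forall a t, 0 < (s a).[t].

(** The cube is a common denominator: the most singular entry, the Laplacian of the Inverse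
    MultiQuadric, is a polynomial times [s^(-5/2)], which is [sqrt s / s^3]. *)
Definition kernel_sum t := alpha - \sum_a \sum_b beta a b *
  ((u a).[t] * Num.sqrt (s a).[t] / (s a).[t] ^+ 3) *
  ((v b).[t] * Num.sqrt (s b).[t] / (s b).[t] ^+ 3).

Let S := \prod_a s a.
Let S' a := \prod_(c | c != a) s c.
Let offdiag := [seq ab <- enum {: I * I} | ab.1 != ab.2].
(* The part of [S ^+ 6 * kernel_sum] that is free of square roots. *)
Definition diag_poly :=
  alpha *: S ^+ 6 - \sum_a beta a a *: (u a * v a * s a * S' a ^+ 6).
Let coef (ab : I * I) : {poly R} :=
  - beta ab.1 ab.2 *: (u ab.1 * v ab.2 * S' ab.1 ^+ 3 * S' ab.2 ^+ 3).
Let root_ab (ab : I * I) t := Num.sqrt (s ab.1).[t] * Num.sqrt (s ab.2).[t].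

Let SE a : s a * S' a = S.
Proof. by rewrite /S (bigD1 a). Qed.

Let S_gt0 t : 0 < S.[t].
Proof. by rewrite /S horner_prod prodr_gt0. Qed.

(** [S ^+ 6] clears the denominators of both factors. For [a = b] the two roots multiply to [s a],
    so the diagonal terms join the polynomial part. *)
Lemma kernel_sum_quasi t :
  quasi_sum offdiag diag_poly (fun=> 1) coef root_ab t = S.[t] ^+ 6 * kernel_sum t.
Proof.
pose f a b := - beta a b * (u a).[t] * (v b).[t] * (S' a).[t] ^+ 3 *
  (S' b).[t] ^+ 3 * (Num.sqrt (s a).[t] * Num.sqrt (s b).[t]).
have -> : S.[t] ^+ 6 * kernel_sum t = alpha * S.[t] ^+ 6 + \sum_a \sum_b f a b.
  rewrite /kernel_sum mulrBr mulrC; congr (_ + _).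
  rewrite mulr_sumr -sumrN; apply: eq_bigr => a _.
  rewrite mulr_sumr -sumrN; apply: eq_bigr => b _.
  have -> : S.[t] ^+ 6 = ((s a).[t] * (S' a).[t]) ^+ 3 * ((s b).[t] * (S' b).[t]) ^+ 3.
    by rewrite -!hornerM !SE -exprD.
  rewrite /f; field.
  by rewrite !gt_eqF.
have -> : \sum_a \sum_b f a b = \sum_a f a a + \sum_(ab <- offdiag) f ab.1 ab.2.
  rewrite big_filter big_enum_cond /= -(pair_big_dep xpredT (fun a b => a != b)) /=.
  rewrite -big_split /=; apply: eq_bigr => a _.
  rewrite (bigD1 a) //=; congr (_ + _); apply: eq_bigl => b; by rewrite eq_sym.
rewrite /quasi_sum mulr1 addrA; congr (_ + _).
  rewrite /diag_poly hornerD hornerZ horner_exp hornerN horner_sum; congr (_ + _).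
  rewrite -sumrN; apply: eq_bigr => a _; rewrite /f !(hornerZ, hornerM, horner_exp).
  have : Num.sqrt (s a).[t] ^+ 2 = (s a).[t] by rewrite sqr_sqrtr // ltW.
  move: (Num.sqrt _) => w <-; ring.
by apply: eq_bigr => ab _; rewrite /coef /root_ab /f !(hornerZ, hornerM, horner_exp);
  ring.
Qed.

Let log_rational_root a : log_rational S (fun t => Num.sqrt (s a).[t]).
Proof. by apply: (log_rational_sqrt S_gt0 (SE a)). Qed.

Let quasi_zeros : infinite_set [set t | kernel_sum t = 0] ->
  (forall t, quasi_sum offdiag diag_poly (fun=> 1) coef root_ab t = 0) /\
  ((forall ab, ab \in offdiag -> poly_indep (fun=> 1) (root_ab ab)) ->
    diag_poly = 0).
Proof.
move=> inf; apply: (quasi_sum_zeros S_gt0).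
- exact: log_rational1.
- by move=> ab _; apply: log_rationalM => //; exact: log_rational_root.
- by apply: sub_infinite_set inf => t /= t0; rewrite kernel_sum_quasi t0 mulr0.
Qed.

Lemma kernel_sum_zeros : infinite_set [set t | kernel_sum t = 0] ->
  forall t, kernel_sum t = 0.
Proof.
move=> /quasi_zeros[q0 _] t; have := q0 t; rewrite kernel_sum_quasi => /eqP.
by rewrite mulf_eq0 expf_eq0 /= (gt_eqF (S_gt0 t)) => /eqP.
Qed.

Hypothesis irr : forall a, irreducible_poly (s a).
Hypothesis cop : forall a b, a != b -> coprimep (s a) (s b).

(** If 1 and the root of [s a * s b] were dependent, squaring would give
    [p ^+ 2 = r ^+ 2 * (s a * s b)], which irreducibility and coprimality exclude for [a != b]
    unless [p = 0]. *)
Lemma kernel_sum_diag : infinite_set [set t | kernel_sum t = 0] -> diag_poly = 0.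
Proof.
move=> /quasi_zeros[_]; apply=> -[a b]; rewrite mem_filter /= => /andP[ab _] p r pr.
apply: (sqr_irreducible_neq (irr a) (cop ab) (r := r)).
apply: poly_eq_horner => t; have := pr t; rewrite mulr1 !(hornerM, horner_exp) => ->.
rewrite /root_ab /= mulrACA; congr (_ * _).
by rewrite mulrACA -!expr2 !sqr_sqrtr // ltW.
Qed.

Variables (k : I -> nat) (W : I -> {poly R}).
Hypothesis k_lt6 : forall a, (k a < 6)%N.
Hypothesis uvW : forall a, u a * v a * s a = s a ^+ k a * W a.
Hypothesis copW : forall a, coprimep (s a) (W a).

(** A comparison of pole orders: [s a ^+ 6] divides [S ^+ 6] and every diagonal term but the one of
    index [a], which carries only [s a ^+ k a] with [k a < 6]. So each [beta a a] vanishes, and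
    [alpha *: S ^+ 6 = 0] remains. *)
Lemma diag_poly_eq0 : diag_poly = 0 -> alpha = 0.
Proof.
move=> D0.
have copS' a : coprimep (s a) (S' a).
  rewrite /S'; elim/big_rec: _ => [|c p ca IH]; first exact: coprimep1.
  by rewrite coprimepMr IH cop // eq_sym.
have beta0 a : beta a a = 0.
  apply/eqP; apply: contraT => ba.
  have dvdS : s a ^+ 6 %| S ^+ 6 by rewrite -(SE a) exprMn dvdp_mulr.
  have dvdS' c : c != a -> s a ^+ 6 %| S' c ^+ 6.
    by move=> ca; rewrite /S' (bigD1 a) 1?eq_sym //= exprMn dvdp_mulr.
  have : s a ^+ 6 %| beta a a *: (u a * v a * s a * S' a ^+ 6).
    move: D0; rewrite /diag_poly (bigD1 a) //= => /eqP.
    rewrite subr_eq0 => /eqP /(canLR (addrK _)) <-.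
    apply: dvdp_sub; first by rewrite -mul_polyC dvdp_mull.
    elim/big_rec: _ => [|c q ca IH]; first exact: dvdp0.
    by rewrite dvdp_add // -mul_polyC dvdp_mull // dvdp_mull // dvdS'.
  rewrite dvdpZr // uvW Gauss_dvdpl; last exact/coprimep_expl/coprimep_expr.
  rewrite -(subnKC (ltnW (k_lt6 a))) exprD dvdp_mul2l; last first.
    by rewrite expf_eq0 negb_and orbC irredp_neq0.
  have -> : (6 - k a = (5 - k a).+1)%N by rewrite -subSn // -ltnS k_lt6.
  rewrite exprS => h; have sW : s a %| W a by apply: dvdp_trans h; exact: dvdp_mulr.
  by have := copW a; rewrite irreducible_poly_coprime // sW.
move: D0; rewrite /diag_poly big1 => [|a _]; last by rewrite beta0 scale0r.
rewrite subr0 => /eqP; rewrite scaler_eq0 => /orP[/eqP //|].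
rewrite expf_eq0 /= => /eqP S0; have := S_gt0 0; by rewrite S0 horner0 ltxx.
Qed.

End kernel_sums.

(** The direction is taken on the moment curve [(1, c, c^2, ...)]: its product with [X a - X b] is
    the value at [c] of a nonzero polynomial, and [c] avoids the roots of the product of all these
    polynomials. *)
Lemma separating_direction (R : realType) k (I : finType) (X : I -> 'rV[R]_k) :
  (0 < k)%N -> injective X -> exists v : 'rV[R]_k, 0 < \sum_l v ord0 l ^+ 2 /\
  forall a b, a != b -> \sum_l v ord0 l * X a ord0 l != \sum_l v ord0 l * X b ord0 l.
Proof.
move=> k0 injX.
pose P := \prod_(ab : I * I | ab.1 != ab.2) rVpoly (X ab.1 - X ab.2).
have P0 : P != 0.
  apply/prodf_neq0 => -[a b] /= ab; apply: contra ab => /eqP/(congr1 (@poly_rV _ k)).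
  by rewrite rVpolyK linear0 => /eqP; rewrite subr_eq0 => /eqP/injX ->.
have [c Pc] : exists c, P.[c] != 0.
  apply: contrapT => /forallNP Pc; move/eqP: P0; apply; apply: poly_eq_horner => t.
  by rewrite horner0; apply: contrapT => /eqP; exact: Pc.
have hv (w : 'rV[R]_k) : (rVpoly w).[c] = \sum_(l < k) c ^+ l * w ord0 l.
  by rewrite horner_poly; apply: eq_bigr => i _; rewrite valK mulrC.
exists (\row_(l < k) c ^+ l); split.
  rewrite (bigD1 (Ordinal k0)) //= mxE expr0 expr1n.
  by rewrite ltr_wpDr ?ltr01 // sumr_ge0 // => i _; exact: sqr_ge0.
have rowE (w : 'rV[R]_k) :
    \sum_l (\row_(l < k) c ^+ l) ord0 l * w ord0 l = \sum_(l < k) c ^+ l * w ord0 l.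
  by apply: eq_bigr => l _; rewrite mxE.
move=> a b ab; apply: contra Pc; rewrite !rowE => /eqP E.
rewrite /P horner_prod (bigD1 (a, b)) //= hv mulf_eq0; apply/orP; left.
apply/eqP; under eq_bigr do rewrite !mxE mulrBr.
by rewrite sumrB E subrr.
Qed.

(** * The argument of the square root along lines *)

Definition rbf_arg (R : realType) k (eps : R) (c x : 'rV[R]_k) :=
  1 + eps ^+ 2 * \sum_l (x ord0 l - c ord0 l) ^+ 2.

Lemma rbf_arg_gt0 (R : realType) k (eps : R) (c x : 'rV[R]_k) : 0 < rbf_arg eps c x.
Proof.
rewrite /rbf_arg ltr_wpDr ?ltr01 // mulr_ge0 ?sqr_ge0 // sumr_ge0 // => i _.
exact: sqr_ge0.
Qed.

Section rbf_arg_line.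
Context (R : realType) (k : nat) (eps : R) (c x v : 'rV[R]_k).

Definition rbf_arg_poly : {poly R} := Poly
  [:: rbf_arg eps c x;
      2 * eps ^+ 2 * \sum_l v ord0 l * (x ord0 l - c ord0 l);
      eps ^+ 2 * \sum_l v ord0 l ^+ 2].

Lemma rbf_arg_polyE t : rbf_arg_poly.[t] = rbf_arg eps c (x + t *: v).
Proof.
rewrite horner_Poly /= /rbf_arg.
under [in RHS]eq_bigr => l _.
  rewrite !mxE.
  have -> : (x ord0 l + t * v ord0 l - c ord0 l) ^+ 2 =
    (x ord0 l - c ord0 l) ^+ 2 +
    (2 * t * (v ord0 l * (x ord0 l - c ord0 l)) + t ^+ 2 * v ord0 l ^+ 2) by ring.
  over.
rewrite !big_split /= -!mulr_sumr; ring.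
Qed.

Lemma rbf_arg_poly_gt0 t : 0 < rbf_arg_poly.[t].
Proof. by rewrite rbf_arg_polyE rbf_arg_gt0. Qed.

Lemma rbf_arg_poly_irreducible : 0 < eps -> 0 < \sum_l v ord0 l ^+ 2 ->
  irreducible_poly rbf_arg_poly.
Proof.
move=> e0 v0; apply: cubic_irreducible.
  by rewrite (@PolyK _ 0) //= mulf_neq0 ?gt_eqF // exprn_gt0.
by move=> t; rewrite /root gt_eqF // rbf_arg_poly_gt0.
Qed.

End rbf_arg_line.

(** Both quadratics have the same leading coefficient, so they differ by a polynomial of degree one;
    its root is real, and there the first quadratic is positive. *)
Lemma rbf_arg_poly_coprime (R : realType) k (eps : R) (a b x v : 'rV[R]_k) :
  0 < eps -> \sum_l v ord0 l * a ord0 l != \sum_l v ord0 l * b ord0 l ->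
  coprimep (rbf_arg_poly eps a x v) (rbf_arg_poly eps b x v).
Proof.
move=> e0 ab.
have E c : \sum_l v ord0 l * (x ord0 l - c ord0 l) =
    \sum_l v ord0 l * x ord0 l - \sum_l v ord0 l * c ord0 l :> R.
  by rewrite -sumrB; apply: eq_bigr => l _; rewrite mulrBr.
pose B := 2 * eps ^+ 2 * (\sum_l v ord0 l * a ord0 l - \sum_l v ord0 l * b ord0 l).
pose C := rbf_arg eps a x - rbf_arg eps b x.
have B0 : B != 0.
  by rewrite mulf_neq0 ?subr_eq0 // mulf_neq0 ?pnatr_eq0 // expf_neq0 // gt_eqF.
have -> : rbf_arg_poly eps b x v = rbf_arg_poly eps a x v + B *: ('X - (C / B)%:P).
  apply: poly_eq_horner => t; rewrite hornerD hornerZ hornerXsubC !horner_Poly /= !E.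
  by rewrite [B * (t - _)]mulrBr [B * (C / B)]mulrC divfK // /C /B; ring.
set s := rbf_arg_poly _ a _ _.
have addsE q : coprimep s (s + q) = coprimep s q.
  by rewrite -[X in X + q]mul1r coprimep_addl_mul.
rewrite addsE coprimepZr // coprimep_XsubC.
by rewrite /root gt_eqF // rbf_arg_poly_gt0.
Qed.

Section multivariate_kernel_sum.
Context (R : realType) (k : nat) (I : finType) (eps alpha : R).
Context (beta : I -> I -> R) (U V : I -> {poly R}) (X : I -> 'rV[R]_k).

Definition mkernel_sum (x : 'rV[R]_k) := let s a := rbf_arg eps (X a) x in
  alpha - \sum_a \sum_b beta a b *
  ((U a).[s a] * Num.sqrt (s a) / s a ^+ 3) *
  ((V b).[s b] * Num.sqrt (s b) / s b ^+ 3).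

Lemma mkernel_sum_line x v t :
  let s a := rbf_arg_poly eps (X a) x v in
  mkernel_sum (x + t *: v) =
  kernel_sum s (fun a => U a \Po s a) (fun a => V a \Po s a) alpha beta t.
Proof.
rewrite /kernel_sum /mkernel_sum /=; congr (_ - _).
by apply: eq_bigr => a _; apply: eq_bigr => b _; rewrite !horner_comp !rbf_arg_polyE.
Qed.

Lemma mkernel_sum_dichotomic : line_dichotomic mkernel_sum.
Proof.
move=> x v inf t; rewrite mkernel_sum_line; apply: kernel_sum_zeros.
  by move=> a u; exact: rbf_arg_poly_gt0.
by apply: sub_infinite_set inf => u /=; rewrite mkernel_sum_line.
Qed.

(** If the sum vanished everywhere, it would vanish on the line through the origin in a separating
    direction, where the arguments are irreducible and pairwise coprime; the diagonal part would
    then give [alpha = 0]. The condition on [(W a).[0]] makes [W a] composed with [s a] coprime to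
    [s a]. *)
Lemma mkernel_sum_neq0 (m : I -> nat) (W : I -> {poly R}) :
  (0 < k)%N -> injective X -> 0 < eps -> alpha != 0 ->
  (forall a, (m a < 6)%N) -> (forall a, U a * V a * 'X = 'X^(m a) * W a) ->
  (forall a, (W a).[0] != 0) -> exists x, mkernel_sum x != 0.
Proof.
move=> k0 injX e0 a0 m6 UVW W0.
have [v [v0 sepv]] := separating_direction k0 injX.
apply: contrapT => /forallNP all0; move/eqP: a0; apply.
pose s a := rbf_arg_poly eps (X a) 0 v.
have s0 a t : 0 < (s a).[t] by exact: rbf_arg_poly_gt0.
have irr a : irreducible_poly (s a) by exact: rbf_arg_poly_irreducible.
have cop a b : a != b -> coprimep (s a) (s b).
  by move=> ab; apply: rbf_arg_poly_coprime => //; exact: sepv.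
have Ds := kernel_sum_diag s0 irr cop.
apply: (diag_poly_eq0 s0 irr cop m6 (W := fun a => W a \Po s a)); last first.
- apply: (Ds (fun a => U a \Po s a) (fun a => V a \Po s a) alpha beta).
  rewrite (_ : [set _ | _] = setT); first exact: infinite_setT_real.
  apply/seteqP; split => // t _ /=; rewrite -mkernel_sum_line.
  by apply: contrapT => /eqP; exact: all0.
- by move=> a; exact: coprime_comp_poly.
move=> a; rewrite -!comp_polyM -[X in _ * X = _](comp_polyX (s a)) -comp_polyM UVW.
by rewrite comp_polyM comp_Xn_poly.
Qed.

End multivariate_kernel_sum.

(** * The radial functions and their Laplacians *)

Lemma is_derive_line (R : realType) k (f : 'rV[R]_k -> R) x v df :
  is_derive (0 : R) (1 : R) (fun t : R => f (x + t *: v)) df -> is_derive x v f df.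
Proof.
move=> [fd fE].
have E : (fun h : R => h^-1 *: (f (h *: v + x) - f x)) =
   (fun h : R => h^-1 *: (f (x + (h *: (1 : R) + 0) *: v) - f (x + (0 : R) *: v))).
  apply/funext => h; rewrite scale0r addr0 addr0 [h *: (1 : R)]mulr1.
  by rewrite [h *: v + x]addrC.
split; first by rewrite /derivable E.
by rewrite /derive E.
Qed.

Section rbf_derivatives.
Context (R : realType) (k : nat) (eps : R) (c : 'rV[R]_k).
Local Notation s := (rbf_arg eps c).

Lemma rbf_atE kind x : rbf_at kind eps c x =
  match kind with
  | MultiQuadric => Num.sqrt (s x)
  | InverseMultiQuadric => (Num.sqrt (s x))^-1
  end.
Proof.
rewrite /rbf_at /rbf exprMn /enorm sqr_sqrtr; last first.
  by rewrite sumr_ge0 // => l _; exact: sqr_ge0.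
by under eq_bigr do rewrite !mxE.
Qed.

Lemma is_derive_rbf_coord x (l : 'I_k) :
  is_derive x (ebasis R l) (fun x => x ord0 l - c ord0 l) 1.
Proof.
apply: is_derive_line.
apply: (is_derive_eqfun (is_derive_poly ('X + (x ord0 l - c ord0 l)%:P) 0)).
  by move=> t; rewrite !hornerE !mxE !eqxx /= mulr1; ring.
by rewrite derivD derivX derivC addr0 hornerC.
Qed.

Lemma is_derive_radial x (l : 'I_k) (g : R -> R) dg :
  is_derive (s x) (1 : R) g dg ->
  is_derive x (ebasis R l) (fun x => g (s x))
    (dg * (2 * eps ^+ 2 * (x ord0 l - c ord0 l))).
Proof.
move=> gd; apply: is_derive_line.
pose q := rbf_arg_poly eps c x (ebasis R l).
have q0 : q.[0] = s x by rewrite rbf_arg_polyE scale0r addr0.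
have qd : q^`().[0] = 2 * eps ^+ 2 * (x ord0 l - c ord0 l).
  rewrite horner_coef0 coef_deriv mulr1n coef_Poly /=.
  rewrite (bigD1 l) //= big1 => [|j jl]; rewrite !mxE ?eqxx /= ?mul1r ?addr0 //.
  by rewrite (negbTE jl) mul0r.
rewrite -q0 in gd.
apply: (is_derive_eqfun (is_derive1_comp gd (is_derive_poly q 0))).
  by move=> t /=; rewrite rbf_arg_polyE.
by rewrite qd.
Qed.

Let sqrt_neq0 (t : R) : 0 < t -> Num.sqrt t != 0.
Proof. by move=> t0; rewrite gt_eqF // sqrtr_gt0. Qed.

Lemma is_derive_invsqrt (t : R) : 0 < t ->
  is_derive t (1 : R) (fun t => (Num.sqrt t)^-1) (- (2 * t * Num.sqrt t)^-1).
Proof.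
move=> t0.
apply: (is_derive_eqfun (is_deriveV (sqrt_neq0 t0) (is_derive1_sqrt t0))) => //.
have -> : 2 * t * Num.sqrt t = 2 * Num.sqrt t ^+ 3.
  by rewrite [in RHS]exprS sqr_sqrtr ?ltW //; ring.
by rewrite /GRing.scale /=; field; exact: sqrt_neq0.
Qed.

Lemma is_derive_invsqrt3 (t : R) : 0 < t ->
  is_derive t (1 : R) (fun t => (t * Num.sqrt t)^-1)
    (- (3 / 2) / (t ^+ 2 * Num.sqrt t)).
Proof.
move=> t0.
have n0 : t * Num.sqrt t != 0 by rewrite mulf_neq0 ?sqrt_neq0 // gt_eqF.
have d1 : is_derive t (1 : R) (fun t : R => t * Num.sqrt t) _ :=
  is_deriveM (is_derive_id t (1 : R)) (is_derive1_sqrt t0).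
have d2 := @is_deriveV _ (fun t : R => t * Num.sqrt t) _ _ _ n0 d1.
apply: (is_derive_eqfun d2) => //.
have w0 := sqrt_neq0 t0; have : Num.sqrt t ^+ 2 = t by rewrite sqr_sqrtr ?ltW.
rewrite /GRing.scale /= /id; move: (Num.sqrt t) w0 => w w0 <-; field.
exact: w0.
Qed.

Let sum_sqr (x : 'rV[R]_k) :
  eps ^+ 2 * \sum_(l < k) (x ord0 l - c ord0 l) ^+ 2 = s x - 1.
Proof. by rewrite /rbf_arg addrC addKr. Qed.

(** The chain rule with [ds/dx_l = 2 eps^2 (x_l - c_l)]; summing over [l], the squares recombine
    into [s - 1], so the Laplacian depends on [s] alone. *)
Lemma laplacian_radial x (g dg dh : R -> R) :
  (forall t : R, 0 < t -> is_derive t (1 : R) g (dg t)) ->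
  (forall t : R, 0 < t -> is_derive t (1 : R) dg (dh t)) ->
  laplacian (fun x => g (s x)) x =
  2 * eps ^+ 2 * (k%:R * dg (s x)) + 4 * eps ^+ 2 * (dh (s x) * (s x - 1)).
Proof.
move=> gd hd.
rewrite -sum_sqr /laplacian.
have E1 (l : 'I_k) : 'D_(ebasis R l) (fun x => g (s x)) =
    (fun x => dg (s x)) * (fun x => 2 * eps ^+ 2 * (x ord0 l - c ord0 l)).
  apply/funext => y.
  by have := is_derive_radial l (gd _ (rbf_arg_gt0 eps c y)) => /@derive_val ->.
have E2 (l : 'I_k) : 'D_(ebasis R l) ('D_(ebasis R l) (fun x => g (s x))) x =
    2 * eps ^+ 2 * dg (s x) +
    4 * eps ^+ 2 * (dh (s x) * (eps ^+ 2 * (x ord0 l - c ord0 l) ^+ 2)).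
  rewrite E1.
  have d1 := is_derive_radial l (hd _ (rbf_arg_gt0 eps c x)).
  have d2 := is_deriveZ (2 * eps ^+ 2) (is_derive_rbf_coord x l).
  have := is_deriveM d1 d2 => /@derive_val ->.
  by rewrite /GRing.scale /= /GRing.scale /=; ring.
under eq_bigr do rewrite E2.
rewrite big_split /= sumr_const card_ord -!mulr_sumr -mulr_natr; ring.
Qed.

(** Numerators over the common power [s^(5/2)], here of the Laplacian and in [val_poly] of the
    function itself. *)
Definition lap_poly kind : {poly R} :=
  match kind with
  | MultiQuadric => eps ^+ 2 *: ((k%:R - 1) *: 'X^2 + 'X)
  | InverseMultiQuadric => eps ^+ 2 *: ((3 - k%:R) *: 'X - 3%:P)
  end.

Definition val_poly kind : {poly R} :=
  match kind with
  | MultiQuadric => 'X^3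
  | InverseMultiQuadric => 'X^2
  end.

Lemma rbf_at_val kind x :
  rbf_at kind eps c x = (val_poly kind).[s x] * Num.sqrt (s x) / s x ^+ 3.
Proof.
have s0 := rbf_arg_gt0 eps c x; rewrite rbf_atE.
have w0 := sqrt_neq0 s0; have : Num.sqrt (s x) ^+ 2 = s x by rewrite sqr_sqrtr ?ltW.
move: (Num.sqrt (s x)) w0 => w w0 <-.
by case: kind; rewrite /= hornerXn; field.
Qed.

Lemma laplacian_rbf_at kind x :
  laplacian (rbf_at kind eps c) x =
  (lap_poly kind).[s x] * Num.sqrt (s x) / s x ^+ 3.
Proof.
have s0 := rbf_arg_gt0 eps c x.
have -> : rbf_at kind eps c = (fun x => match kind with
   | MultiQuadric => Num.sqrt | InverseMultiQuadric => fun t => (Num.sqrt t)^-1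
   end (s x)).
  by apply/funext => y; rewrite rbf_atE; case: kind.
have w0 := sqrt_neq0 s0; have : Num.sqrt (s x) ^+ 2 = s x by rewrite sqr_sqrtr ?ltW.
case: kind.
  have d1 (t : R) : 0 < t ->
      is_derive t (1 : R) (fun t => (2 * Num.sqrt t)^-1) (- (4 * t * Num.sqrt t)^-1).
    move=> t0; have d := is_deriveZ (2^-1 : R) (is_derive_invsqrt t0).
    apply: (is_derive_eqfun d) => [u|]; first by rewrite invfM.
    by rewrite /GRing.scale /=; field; rewrite sqrt_neq0 // gt_eqF.
  rewrite (laplacian_radial x (@is_derive1_sqrt R) d1) /=.
  rewrite !(hornerD, hornerN, hornerZ, hornerXn, hornerX, hornerC).
  by move: (Num.sqrt (s x)) w0 => w w0 <-; field; exact: w0.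
have d1 (t : R) : 0 < t -> is_derive t (1 : R) (fun t => - (2 * t * Num.sqrt t)^-1)
    (3 / 4 / (t ^+ 2 * Num.sqrt t)).
  move=> t0; have d := is_deriveZ (- 2^-1 : R) (is_derive_invsqrt3 t0).
  apply: (is_derive_eqfun d) => [u|].
    by rewrite -[2 * u * _]mulrA [in RHS]invfM -mulNr.
  by rewrite /GRing.scale /=; field; rewrite sqrt_neq0 // gt_eqF.
rewrite (laplacian_radial x (@is_derive_invsqrt) d1) /=.
rewrite !(hornerD, hornerN, hornerZ, hornerXn, hornerX, hornerC).
by move: (Num.sqrt (s x)) w0 => w w0 <-; field; exact: w0.
Qed.

End rbf_derivatives.

(** * Adding a point *)

(** Block elimination writes [M] as a unipotent upper triangular matrix times a lower triangular
    one, so [\det M] is the Schur complement of [K] times [\det K]. *)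
Lemma bordered_unitmx (F : fieldType) N (M : 'M[F]_N.+1) (K : 'M[F]_N) :
  K \in unitmx -> (forall i j, M (lift ord0 i) (lift ord0 j) = K i j) ->
  (M \in unitmx) = (M ord0 ord0 - \sum_a \sum_b invmx K a b *
     M ord0 (lift ord0 a) * M (lift ord0 b) ord0 != 0).
Proof.
move=> uK MK.
pose r := \row_j M ord0 (lift ord0 j); pose c := \col_i M (lift ord0 i) ord0.
have ME : M = block_mx ((M ord0 ord0)%:M) r c K :> 'M[F]_(1 + N).
  apply/matrixP => i j.
  have L (a : 'I_1) : lshift N a = ord0 :> 'I_N.+1 by apply: val_inj; rewrite (ord1 a).
  have Rs (a : 'I_N) : rshift 1 a = lift ord0 a :> 'I_N.+1 by exact: val_inj.
  case: (@split_ordP 1 N i) => a ->; case: (@split_ordP 1 N j) => b ->.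
  - by rewrite block_mxEul !mxE (ord1 a) (ord1 b) eqxx mulr1n !L.
  - by rewrite block_mxEur !mxE L Rs.
  - by rewrite block_mxEdl !mxE L Rs.
  - by rewrite block_mxEdr -MK !Rs.
have facE : M = block_mx 1%:M (r *m invmx K) 0 1%:M *m
    block_mx ((M ord0 ord0)%:M - r *m invmx K *m c) 0 c K :> 'M[F]_(1 + N).
  by rewrite mulmx_block !mul1mx !mul0mx !add0r mulmxKV // subrK -ME.
have detM : \det M = ((M ord0 ord0)%:M - r *m invmx K *m c) ord0 ord0 * \det K.
  rewrite [in LHS]facE.
  have := det_mulmx (block_mx 1%:M (r *m invmx K) 0 1%:M)
    (block_mx ((M ord0 ord0)%:M - r *m invmx K *m c) 0 c K : 'M[F]_(1 + N)).
  by rewrite det_ublock !det1 !mul1r det_lblock det_mx11.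
rewrite unitmxE detM unitfE mulf_eq0 negb_or -(unitfE (\det K)) -(unitmxE K) uK andbT.
congr (_ != 0); rewrite mxE mxE eqxx mulr1n !mxE; congr (_ - _).
rewrite exchange_big; apply: eq_bigr => b _; rewrite !mxE mulr_suml.
by apply: eq_bigr => a _; rewrite !mxE [invmx K a b * _]mulrC.
Qed.

Section kansa_entries.
Context (R : realType) (d : nat) (kind : rbf_kind) (eps : R) (m : nat).
Context (Q : 'I_m -> 'rV[R]_d).

Definition kansa_center n (P : 'I_n -> 'rV[R]_d) (j : 'I_(n + m)) :=
  match fintype.split j with inl a => P a | inr h => Q h end.

Lemma kansa_matrixE n (P : 'I_n -> 'rV[R]_d) i j :
  kansa_matrix kind eps P Q i j =
  match fintype.split i with
  | inl a => laplacian (rbf_at kind eps (kansa_center P j)) (P a)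
  | inr h => rbf_at kind eps (kansa_center P j) (Q h)
  end.
Proof.
rewrite /kansa_matrix /kansa_center.
case: (split_ordP i) => a ->; case: (split_ordP j) => b ->;
  by rewrite ?(block_mxEul, block_mxEur, block_mxEdl, block_mxEdr) mxE
    ?(lshiftK, rshiftK, unsplitK (inl _), unsplitK (inr _)).
Qed.

(** With a list, a new point is put in front: it takes row and column [ord0], and the old matrix is
    the block indexed by [lift ord0]. *)
Definition kansa_seq n (s : seq 'rV[R]_d) :=
  kansa_matrix kind eps (fun i : 'I_n => nth 0 s i) Q.

Lemma split_lift n (i : 'I_(n + m)) :
  fintype.split (lift ord0 i : 'I_(n.+1 + m)) =
  match fintype.split i with inl a => inl (lift ord0 a) | inr h => inr h end.
Proof.
case: (split_ordP i) => a ->.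
  have -> : lift ord0 (lshift m a) = lshift m (lift ord0 a) :> 'I_(n.+1 + m).
    exact: val_inj.
  by rewrite (unsplitK (inl _)).
have -> : lift ord0 (rshift n a) = rshift n.+1 a :> 'I_(n.+1 + m).
  exact: val_inj.
by rewrite (unsplitK (inr _)).
Qed.

Lemma split_ord0 n : fintype.split (ord0 : 'I_(n.+1 + m)) = inl ord0.
Proof.
have -> : ord0 = lshift m ord0 :> 'I_(n.+1 + m) by exact: val_inj.
by rewrite (unsplitK (inl _)).
Qed.

Lemma kansa_center_cons n x s (j : 'I_(n + m)) :
  kansa_center (fun i : 'I_n.+1 => nth 0 (x :: s) i) (lift ord0 j) =
  kansa_center (fun i : 'I_n => nth 0 s i) j.
Proof. by rewrite /kansa_center split_lift; case: fintype.split. Qed.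

Lemma kansa_center0 n x s :
  kansa_center (fun i : 'I_n.+1 => nth 0 (x :: s) i) ord0 = x.
Proof. by rewrite /kansa_center split_ord0. Qed.

(** Equal centres would give equal columns. Distinctness of the random points thus follows from
    nonsingularity, without a null set of its own. *)
Lemma kansa_center_inj n (P : 'I_n -> 'rV[R]_d) :
  kansa_matrix kind eps P Q \in unitmx -> injective (kansa_center P).
Proof.
move=> uK a b ab.
have : delta_mx a ord0 = delta_mx b ord0 :> 'cV[R]_(n + m).
  rewrite -[LHS](mulKmx uK) -[RHS](mulKmx uK) -!colE; congr (_ *m _).
  by apply/colP => i; rewrite [LHS]mxE [RHS]mxE !kansa_matrixE ab.
move/colP/(_ a); rewrite !mxE !eqxx /= andbT.
by case: (a =P b) => // _ /eqP; rewrite oner_eq0.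
Qed.

Lemma rbf_argC (a b : 'rV[R]_d) : rbf_arg eps a b = rbf_arg eps b a.
Proof.
rewrite /rbf_arg; congr (_ + _ * _); apply: eq_bigr => l _; ring.
Qed.

(** At its own centre [s = 1], where the Laplacian is [eps^2 d] for the MultiQuadric and [- eps^2 d]
    for its inverse. *)
Lemma lap_poly_self : (0 < d)%N -> 0 < eps -> (lap_poly d eps kind).[1] != 0.
Proof.
move=> d0 e0; have e2 : eps ^+ 2 != 0 by rewrite expf_neq0 // gt_eqF.
have dn : d%:R != 0 :> R by rewrite pnatr_eq0 -lt0n.
have d1 : (3 - d%:R) - 3 = - d%:R :> R by ring.
by case: kind; rewrite /= !(hornerD, hornerN, hornerZ, hornerXn, hornerX, hornerC)
  ?expr1n mulr1 ?subrK ?d1 mulf_neq0 // oppr_eq0.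
Qed.

Let center n (s : seq 'rV[R]_d) := kansa_center (fun i : 'I_n => nth 0 s i).

Lemma kansa_seq_lift n x s (i j : 'I_(n + m)) :
  kansa_seq n.+1 (x :: s) (lift ord0 i) (lift ord0 j) = kansa_seq n s i j.
Proof.
rewrite /kansa_seq !kansa_matrixE kansa_center_cons split_lift.
by case: fintype.split.
Qed.

Lemma kansa_seq00 n x s : kansa_seq n.+1 (x :: s) ord0 ord0 = (lap_poly d eps kind).[1].
Proof.
rewrite /kansa_seq kansa_matrixE kansa_center0 split_ord0 laplacian_rbf_at /=.
have -> : rbf_arg eps x x = 1.
  by rewrite /rbf_arg big1 ?mulr0 ?addr0 // => l _; rewrite subrr expr0n.
by rewrite sqrtr1 expr1n divr1 mulr1.
Qed.

Lemma kansa_seq_row n x s (j : 'I_(n + m)) (t := rbf_arg eps (@center n s j) x) :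
  kansa_seq n.+1 (x :: s) ord0 (lift ord0 j) =
  (lap_poly d eps kind).[t] * Num.sqrt t / t ^+ 3.
Proof.
by rewrite /kansa_seq kansa_matrixE kansa_center_cons split_ord0 laplacian_rbf_at.
Qed.

(** In the new column the rows of interior points carry Laplacians and those of the [Q] carry
    values, whereas the new row consists of Laplacians only. *)
Let col_poly n (i : 'I_(n + m)) :=
  if fintype.split i is inl _ then lap_poly d eps kind else val_poly R kind.

Lemma kansa_seq_col n x s (i : 'I_(n + m)) (t := rbf_arg eps (@center n s i) x) :
  kansa_seq n.+1 (x :: s) (lift ord0 i) ord0 =
  (col_poly i).[t] * Num.sqrt t / t ^+ 3.
Proof.
rewrite /t /center /kansa_seq kansa_matrixE kansa_center0 split_lift.
rewrite /col_poly /kansa_center.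
case: fintype.split => a /=; last by rewrite rbf_at_val rbf_argC.
by rewrite laplacian_rbf_at rbf_argC.
Qed.

Lemma kansa_bordering_null n (s : seq 'rV[R]_d) : (0 < d)%N -> 0 < eps ->
  kansa_seq n s \in unitmx ->
  null_for (@lebesgue_rV R d) [set x | kansa_seq n.+1 (x :: s) \notin unitmx].
Proof.
move=> d0 e0 uK.
pose G := mkernel_sum eps (lap_poly d eps kind).[1] (invmx (kansa_seq n s))
            (fun=> lap_poly d eps kind) (@col_poly n) (@center n s).
have GE x : (kansa_seq n.+1 (x :: s) \in unitmx) = (G x != 0).
  rewrite (@bordered_unitmx _ (n + m) _ _ uK (kansa_seq_lift x s)).
  congr (_ != 0); rewrite /G /mkernel_sum; congr (_ - _); first exact: kansa_seq00.
  apply: eq_bigr => a _; apply: eq_bigr => b _.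
  congr (_ * _ * _); [exact: kansa_seq_row|exact: kansa_seq_col].
have [p Gp] : exists p, G p != 0.
  (* [W] and [e] split off the power of ['X] in the row polynomial times the column polynomial times
     ['X]. At 0 the four cases of [W] are [eps^4], [eps^2], [9 eps^4] and [- 3 eps^2]. *)
  pose W (a : 'I_(n + m)) : {poly R} := match kind, fintype.split a with
    | MultiQuadric, inl _ => (eps ^+ 2 *: ((d%:R - 1) *: 'X + 1)) ^+ 2
    | MultiQuadric, inr _ => eps ^+ 2 *: ((d%:R - 1) *: 'X + 1)
    | InverseMultiQuadric, inl _ => lap_poly d eps kind ^+ 2
    | InverseMultiQuadric, inr _ => lap_poly d eps kind
    end.
  pose e (a : 'I_(n + m)) := match kind, fintype.split a with
    | MultiQuadric, inl _ => 3%N | MultiQuadric, inr _ => 5%N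
    | InverseMultiQuadric, inl _ => 1%N | InverseMultiQuadric, inr _ => 3%N
    end.
  apply: (@mkernel_sum_neq0 _ _ _ _ _ _ _ _ _ e W) => //.
  - exact: kansa_center_inj.
  - exact: lap_poly_self.
  - by move=> a; rewrite /e; case: kind; case: fintype.split.
  - move=> a; rewrite /col_poly /e /W; case: kind; case: fintype.split => i /=;
      rewrite -?mul_polyC; ring.
  - have e2 : eps ^+ 2 != 0 by rewrite expf_neq0 // gt_eqF.
    move=> a; rewrite /W; case: kind; case: fintype.split => i /=;
    rewrite ?horner_exp ?expf_neq0 // !(hornerD, hornerN, hornerZ, hornerX, hornerC);
    by rewrite mulr0 ?add0r mulf_neq0 // ?oner_eq0 // oppr_eq0 pnatr_eq0.
have -> : [set x | kansa_seq n.+1 (x :: s) \notin unitmx] = [set x | G x = 0].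
  by apply/seteqP; split => x /=; rewrite GE negbK => /eqP.
by apply: line_dichotomic_null Gp; exact: mkernel_sum_dichotomic.
Qed.

End kansa_entries.

(** * Micchelli's theorem *)

Section gram_powers.
Context (R : realType) (I : finType) (D : nat) (w : I -> 'rV[R]_D).

Definition gram i j := \sum_l w i ord0 l * w j ord0 l.

Definition kernel_form (F : R -> R) (b : I -> R) :=
  \sum_i \sum_j b i * b j * F (gram i j).

Local Notation q k := (kernel_form (fun z => z ^+ k)).

Lemma kernel_form_pow0 b : q 0 b = (\sum_i b i) ^+ 2.
Proof.
rewrite /kernel_form expr2 mulr_suml; apply: eq_bigr => i _.
by rewrite mulr_sumr; apply: eq_bigr => j _; rewrite expr0 mulr1.
Qed.

(** Expanding one factor of the Gram entry in coordinates; this is the induction step of Schur's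
    product theorem. *)
Lemma kernel_form_powS k b :
  q k.+1 b = \sum_l q k (fun i => b i * w i ord0 l).
Proof.
rewrite /kernel_form [RHS]exchange_big /=; apply: eq_bigr => i _.
rewrite [RHS]exchange_big /=; apply: eq_bigr => j _.
rewrite exprS mulrA mulr_sumr mulr_suml; apply: eq_bigr => l _; ring.
Qed.

Lemma kernel_form_pow_ge0 k b : 0 <= q k b.
Proof.
elim: k b => [|k IH] b; first by rewrite kernel_form_pow0 sqr_ge0.
by rewrite kernel_form_powS sumr_ge0.
Qed.

(** The form is the squared norm of the tensor [sum_i b_i w_i^(tensor k)], and the sum in the
    conclusion is the contraction of this tensor with the [k]-th tensor power of [v]. *)
Lemma kernel_form_pow_eq0 k b (v : 'rV[R]_D) : q k b = 0 ->
  \sum_i b i * (\sum_l v ord0 l * w i ord0 l) ^+ k = 0.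
Proof.
elim: k b => [|k IH] b.
  rewrite kernel_form_pow0 => /eqP; rewrite sqrf_eq0 => /eqP b0.
  by under eq_bigr do rewrite expr0 mulr1.
rewrite kernel_form_powS => /eqP; rewrite psumr_eq0; last first.
  by move=> l _; exact: kernel_form_pow_ge0.
move=> /allP q0.
transitivity (\sum_l v ord0 l * \sum_i (b i * w i ord0 l) *
    (\sum_l v ord0 l * w i ord0 l) ^+ k).
  under [RHS]eq_bigr do rewrite mulr_sumr.
  rewrite [RHS]exchange_big /=; apply: eq_bigr => i _.
  rewrite exprS mulrA mulr_sumr mulr_suml; apply: eq_bigr => l _; ring.
rewrite big1 // => l _; rewrite IH ?mulr0 //.
by apply/eqP; have := q0 l (mem_index_enum l).
Qed.

(** Along a separating direction all moments of the weights [b] at the distinct nodes [t i] vanish;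
    testing with the polynomial that vanishes at every node but one isolates [b i]. *)
Lemma kernel_form_strict b : (0 < D)%N -> injective w ->
  (forall k, q k b = 0) -> forall i, b i = 0.
Proof.
move=> D0 injw q0 i; have [v [_ sepv]] := separating_direction D0 injw.
pose t i := \sum_l v ord0 l * w i ord0 l.
have bp (p : {poly R}) : \sum_i b i * p.[t i] = 0.
  under eq_bigr do rewrite horner_coef mulr_sumr.
  rewrite exchange_big big1 //= => k _.
  under eq_bigr do rewrite mulrCA.
  by rewrite -mulr_sumr kernel_form_pow_eq0 // mulr0.
pose p := \prod_(j | j != i) ('X - (t j)%:P).
have pj j : j != i -> p.[t j] = 0.
  by move=> ji; rewrite horner_prod (bigD1 j) //= hornerXsubC subrr mul0r.
have pi0 : p.[t i] != 0.
  rewrite horner_prod; apply/prodf_neq0 => j ji.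
  by rewrite hornerXsubC subr_eq0 eq_sym sepv.
have := bp p; rewrite (bigD1 i) //= big1 => [/eqP|j ji]; last by rewrite pj ?mulr0.
by rewrite addr0 mulf_eq0 (negbTE pi0) orbF => /eqP.
Qed.

Lemma kernel_form_poly_ge (p : {poly R}) k b : (forall i, 0 <= p`_i) ->
  p`_k * q k b <= kernel_form (horner p) b.
Proof.
move=> p0.
have -> : kernel_form (horner p) b = \sum_(i < size p) p`_i * q i b.
  under [RHS]eq_bigr do rewrite mulr_sumr.
  rewrite [RHS]exchange_big; apply: eq_bigr => i _.
  under [RHS]eq_bigr do rewrite mulr_sumr.
  rewrite [RHS]exchange_big; apply: eq_bigr => j _.
  by rewrite horner_coef mulr_sumr; apply: eq_bigr => l _; rewrite mulrCA.
have [kp|kp] := ltnP k (size p); last first.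
  rewrite nth_default // mul0r sumr_ge0 // => i _.
  by rewrite mulr_ge0 // kernel_form_pow_ge0.
rewrite (bigD1 (Ordinal kp)) //= lerDl sumr_ge0 // => i _.
by rewrite mulr_ge0 // kernel_form_pow_ge0.
Qed.

(** Replaces a power series with nonnegative coefficients: a bound on the [k]-th coefficient that is
    uniform in the approximating polynomials survives the limit. *)
Lemma kernel_form_lim_ge (P : nat -> {poly R}) (F : R -> R) k c N0 b :
  (forall N i, 0 <= (P N)`_i) -> (forall N, (N0 <= N)%N -> c <= (P N)`_k) ->
  (forall i j, (P N).[gram i j] @[N --> \oo] --> F (gram i j)) ->
  c * q k b <= kernel_form F b.
Proof.
move=> P0 Pc PF.
have cv : kernel_form (horner (P N)) b @[N --> \oo] --> kernel_form F b.
  apply: cvg_big => [|i _]; first exact: add_continuous.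
  apply: cvg_big => [|j _]; first exact: add_continuous.
  by apply: cvgM; [exact: cvg_cst|exact: PF].
apply: (@cvgr_to_ge _ _ _ _ _ _ _ cv); near=> N.
apply: le_trans (kernel_form_poly_ge k b (P0 N)).
rewrite ler_wpM2r ?kernel_form_pow_ge0 // Pc //; near: N.
exact: nbhs_infty_ge.
Unshelve. all: by end_near. Qed.

End gram_powers.

(* Fixed-point iteration for [y = (z + y^2) / 2], solved by [1 - sqrt (1 - z)];
   the coefficients of its iterates are nonnegative. *)
Fixpoint sqrt_iter (R : realType) N : {poly R} :=
  if N is N'.+1 then 2^-1 *: ('X + sqrt_iter R N' ^+ 2) else 0.

Section sqrt_iter.
Context (R : realType).
Local Notation h := (sqrt_iter R).

Lemma coef_mul_ge (p r : {poly R}) i j : (forall k, 0 <= p`_k) ->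
  (forall k, 0 <= r`_k) -> p`_i * r`_j <= (p * r)`_(i + j).
Proof.
move=> p0 r0; rewrite coefM.
have ij : (i < (i + j).+1)%N by rewrite ltnS leq_addr.
rewrite (bigD1 (Ordinal ij)) //= addKn lerDl sumr_ge0 // => k _.
exact: mulr_ge0.
Qed.

Lemma coef_mul_ge0 (p r : {poly R}) : (forall k, 0 <= p`_k) ->
  (forall k, 0 <= r`_k) -> forall k, 0 <= (p * r)`_k.
Proof. by move=> p0 r0 k; rewrite coefM sumr_ge0 // => i _; exact: mulr_ge0. Qed.

Lemma coef_sqrt_iter_ge0 N k : 0 <= (h N)`_k.
Proof.
elim: N k => [|N IH] k /=; first by rewrite coef0.
rewrite coefZ coefD coefX mulr_ge0 ?invr_ge0 // addr_ge0 ?ler0n //.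
exact: coef_mul_ge0.
Qed.

(** The coefficient of degree 1 is at least 1/2, and half the square of an iterate multiplies it
    with the one of degree [k]; each further degree therefore costs a factor 1/4. *)
Lemma coef_sqrt_iter_gt0 k : (0 < k)%N ->
  exists2 c : R, 0 < c & forall N, (k <= N)%N -> c <= (h N)`_k.
Proof.
have h1 N : (1 <= N)%N -> 2^-1 <= (h N)`_1.
  case: N => // N _; rewrite /= coefZ coefD coefX /= ler_peMr ?invr_ge0 //.
  by rewrite lerDl; apply: coef_mul_ge0; exact: coef_sqrt_iter_ge0.
case: k => // k _; elim: k => [|k [c c0 IH]].
  by exists 2^-1; rewrite ?invr_gt0.
exists (2^-1 * (2^-1 * c)); first by rewrite !mulr_gt0 ?invr_gt0.
case=> // N kN; rewrite /= coefZ ler_wpM2l ?invr_ge0 // coefD coefX add0r.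
apply: le_trans (@coef_mul_ge (h N) (h N) 1 k.+1 _ _); try exact: coef_sqrt_iter_ge0.
apply: ler_pM (h1 N (leq_trans (ltn0Sn k) kN)) (IH N kN); rewrite ?invr_ge0 //.
exact: ltW.
Qed.

(** With [r] the fixed point for [|z|], the iterates stay below [r] in absolute value, and the error
    is multiplied at each step by [(h_N + y) / 2], at most the maximum of [r] and [|y|], which is
    less than 1. *)
Lemma sqrt_iter_bound (z : R) : `|z| < 1 -> exists rho : R, [/\ 0 <= rho, rho < 1,
  forall N, `|(h N).[z]| <= rho &
  forall N, `|(h N).[z] - (1 - Num.sqrt (1 - z))| <= rho ^+ N].
Proof.
move=> z1; pose y := 1 - Num.sqrt (1 - z); pose r := 1 - Num.sqrt (1 - `|z|).
have z0 : 0 <= 1 - z by rewrite subr_ge0 ltW // (le_lt_trans (ler_norm z)).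
have az0 : 0 < 1 - `|z| by rewrite subr_gt0.
have yE : y = 2^-1 * (z + y ^+ 2).
  have := sqr_sqrtr z0; rewrite /y; move: (Num.sqrt (1 - z)) => u u2.
  by rewrite (_ : z = 1 - u ^+ 2); [field|rewrite u2; ring].
have rE : r = 2^-1 * (`|z| + r ^+ 2).
  have := sqr_sqrtr (ltW az0); rewrite /r; move: (Num.sqrt _) => u u2.
  by rewrite (_ : `|z| = 1 - u ^+ 2); [field|rewrite u2; ring].
have r1 : r < 1 by rewrite /r ltrBlDr ltrDl sqrtr_gt0.
have r0 : 0 <= r.
  by rewrite /r subr_ge0 -[leRHS]sqrtr1 ler_wsqrtr // lerBlDr lerDl.
have y1 : `|y| < 1.
  have u2 := sqr_sqrtr z0; have u0 := sqrtr_ge0 (1 - z).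
  move: z1; rewrite /y !ltr_norml => /andP[zl zr].
  move: (Num.sqrt (1 - z)) u0 u2 => u u0 u2; apply/andP; split; nra.
have hr N : `|(h N).[z]| <= r.
  elim: N => [|N IH] /=; first by rewrite horner0 normr0.
  rewrite hornerZ hornerD hornerX horner_exp normrM [`|2^-1|]ger0_norm ?invr_ge0 //.
  rewrite [leRHS]rE ler_wpM2l ?invr_ge0 // (le_trans (ler_normD _ _)) // lerD2l normrX.
  by rewrite lerXn2r // nnegrE.
exists (Num.max r `|y|); split=> [|| N | N].
- by rewrite le_max r0.
- by rewrite gt_max r1 y1.
- by rewrite le_max hr.
rewrite -/y; elim: N => [|N IH] /=; first by rewrite horner0 sub0r normrN expr0 ltW.
rewrite hornerZ hornerD hornerX horner_exp {1}yE.
have -> : 2^-1 * (z + (h N).[z] ^+ 2) - 2^-1 * (z + y ^+ 2) =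
  2^-1 * ((h N).[z] + y) * ((h N).[z] - y) by ring.
rewrite normrM exprS ler_pM //.
rewrite normrM [`|2^-1|]ger0_norm ?invr_ge0 // mulrC ler_pdivrMr //.
rewrite (le_trans (ler_normD _ _)) // mulr_natr mulr2n lerD //.
  by rewrite le_max hr.
by rewrite le_max lexx orbT.
Qed.

End sqrt_iter.

Section sqrt_iter_limits.
Context (R : realType).
Local Notation h := (sqrt_iter R).

Lemma cvg_le_expr (u : nat -> R) (l rho : R) : 0 <= rho -> rho < 1 ->
  (forall N, `|u N - l| <= rho ^+ N) -> u N @[N --> \oo] --> l.
Proof.
move=> r0 r1 ul; apply/cvgrPdist_le => e e0.
have rc : (fun N => rho ^+ N) @ \oo --> (0 : R) by apply: cvg_expr; rewrite ger0_norm.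
have /cvgrPdist_le /(_ _ e0) := rc; apply: filterS => N.
rewrite sub0r normrN ger0_norm ?exprn_ge0 // => re.
by rewrite distrC (le_trans (ul N)).
Qed.

Lemma sqrt_iter_cvg (z : R) : `|z| < 1 ->
  (h N).[z] @[N --> \oo] --> 1 - Num.sqrt (1 - z).
Proof. by move=> /sqrt_iter_bound[rho [r0 r1 _ H]]; exact: cvg_le_expr H. Qed.

(** The truncated geometric series of [1 / (1 - h N)], where [1 - h N] tends to [sqrt (1 - z)]. *)
Definition invsqrt_iter N : {poly R} := \sum_(j < N) h N ^+ j.

Lemma coef_invsqrt_iter_ge0 N k : 0 <= (invsqrt_iter N)`_k.
Proof.
rewrite coef_sum sumr_ge0 // => j _; elim: (j : nat) k => [|i IH] k.
  by rewrite expr0 coef1 ler0n.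
by rewrite exprS coef_mul_ge0 // => l; exact: coef_sqrt_iter_ge0.
Qed.

Lemma coef_invsqrt_iter_gt0 k :
  exists2 c : R, 0 < c & exists N0, forall N, (N0 <= N)%N -> c <= (invsqrt_iter N)`_k.
Proof.
have pos N i l : 0 <= (h N ^+ i)`_l.
  elim: i l => [|i IH] l; first by rewrite expr0 coef1 ler0n.
  by rewrite exprS coef_mul_ge0 // => j; exact: coef_sqrt_iter_ge0.
case: k => [|k].
  exists 1 => //; exists 1%N => -[//|N] _.
  by rewrite /invsqrt_iter big_ord_recl expr0 coefD coef1 lerDl coef_sum sumr_ge0.
have [c c0 cN] := coef_sqrt_iter_gt0 R (ltn0Sn k).
(* The bound makes [N] at least the degree [k.+1] and at least 2, so that the summand [j = 1], which
   is [h N] itself, is present. *)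
exists c => //; exists k.+2 => -[//|[//|N]] kN.
rewrite /invsqrt_iter big_ord_recl big_ord_recl !coefD expr1.
apply: (le_trans (cN N.+2 (ltnW kN))).
by rewrite addrCA lerDl addr_ge0 // coef_sum sumr_ge0.
Qed.

Lemma invsqrt_iter_cvg (z : R) : `|z| < 1 ->
  (invsqrt_iter N).[z] @[N --> \oo] --> (Num.sqrt (1 - z))^-1.
Proof.
move=> z1; have [rho [r0 r1 hr _]] := sqrt_iter_bound z1.
have s0 : Num.sqrt (1 - z) != 0.
  by rewrite gt_eqF // sqrtr_gt0 subr_gt0 (le_lt_trans (ler_norm _)).
have hE : (fun N => (invsqrt_iter N).[z]) =
    (fun N => (1 - (h N).[z] ^+ N) * (1 - (h N).[z])^-1).
  apply/funext => N; rewrite /invsqrt_iter horner_sum.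
  under eq_bigr do rewrite horner_exp.
  have x1 : 1 - (h N).[z] != 0.
    by rewrite subr_eq0 gt_eqF // (le_lt_trans (ler_norm _)) // (le_lt_trans (hr N)).
  have := subrX1 (h N).[z] N; move: (\sum_(i < N) _) => S SE.
  by apply: (mulIf x1); rewrite divfK // -[LHS]opprK -mulrN opprB mulrC -SE opprB.
rewrite hE (_ : _^-1 = (1 - 0) * (Num.sqrt (1 - z))^-1); last by rewrite subr0 mul1r.
apply: cvgM.
  apply: cvgB; first exact: cvg_cst.
  apply: (cvg_le_expr (rho := rho)) => // N.
  by rewrite subr0 normrX lerXn2r // nnegrE.
apply: cvgV => //.
have -> : Num.sqrt (1 - z) = 1 - (1 - Num.sqrt (1 - z)) by ring.
by apply: cvgB; [exact: cvg_cst|exact: sqrt_iter_cvg].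
Qed.

End sqrt_iter_limits.

(** * Nonsingularity of the interpolation matrix *)

Section rbf_gram.
Context (R : realType) (d m : nat) (eps : R) (Q : 'I_m -> 'rV[R]_d).
Hypotheses (e0 : 0 < eps) (injQ : injective Q).

Let n i := eps ^+ 2 * \sum_l Q i ord0 l ^+ 2.
Let a i := 1 + n i.
Let dot i j := eps ^+ 2 * \sum_l Q i ord0 l * Q j ord0 l.

(* With [a = 1 + |x|^2] and [w = (|x|^2, sqrt 2 x) / a] one has
   [1 + |x - y|^2 = a_x a_y (1 - <w_x, w_y>)], so that the kernel is, up to a
   diagonal scaling, a function of a Gram matrix. *)
Let w i := rV_cons (n i / a i, (Num.sqrt 2 * eps / a i) *: Q i).

Let n_ge0 i : 0 <= n i.
Proof. by rewrite mulr_ge0 ?sqr_ge0 // sumr_ge0 // => l _; exact: sqr_ge0. Qed.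

Let a_gt0 i : 0 < a i.
Proof. by rewrite ltr_wpDr. Qed.

Let a_neq0 i : a i != 0. Proof. by rewrite gt_eqF. Qed.

Let gram_w i j : gram w i j = (n i * n j + 2 * dot i j) / (a i * a j).
Proof.
rewrite /gram big_ord_recl /w !mxE unlift_none /=.
under eq_bigr do rewrite !mxE liftK !mxE.
have -> : \sum_(l < d) Num.sqrt 2 * eps / a i * Q i ord0 l *
    (Num.sqrt 2 * eps / a j * Q j ord0 l) =
    Num.sqrt 2 ^+ 2 * dot i j / (a i * a j).
  rewrite /dot !mulr_sumr mulr_suml; apply: eq_bigr => l _.
  by field; rewrite !a_neq0.
by rewrite sqr_sqrtr ?ler0n //; field; rewrite !a_neq0.
Qed.

Let rbf_arg_dot i j : rbf_arg eps (Q j) (Q i) = 1 + n i + n j - 2 * dot i j.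
Proof.
rewrite /rbf_arg /n /dot.
under eq_bigr => l _.
  rewrite (_ : _ ^+ 2 = Q i ord0 l ^+ 2 + Q j ord0 l ^+ 2 +
     (- 2) * (Q i ord0 l * Q j ord0 l)); last by ring.
  over.
rewrite !big_split /= -mulr_sumr; ring.
Qed.

Let rbf_arg_dotN i j : rbf_arg eps (- Q j) (Q i) = 1 + n i + n j + 2 * dot i j.
Proof.
rewrite /rbf_arg /n /dot.
under eq_bigr => l _.
  rewrite !mxE (_ : _ ^+ 2 = Q i ord0 l ^+ 2 + Q j ord0 l ^+ 2 +
     2 * (Q i ord0 l * Q j ord0 l)); last by ring.
  over.
rewrite !big_split /= -mulr_sumr; ring.
Qed.

Let rbf_arg_gram i j : rbf_arg eps (Q j) (Q i) = a i * a j * (1 - gram w i j).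
Proof.
rewrite rbf_arg_dot gram_w /a; field.
by rewrite -!/(a _) !a_neq0.
Qed.

(** The upper bound is positivity of the argument at [Q i] and [Q j]; the lower one follows from its
    positivity with [Q j] replaced by [- Q j]. *)
Let gram_lt1 i j : `|gram w i j| < 1.
Proof.
have aa := mulr_gt0 (a_gt0 i) (a_gt0 j).
have p1 := rbf_arg_gt0 eps (Q j) (Q i); have p2 := rbf_arg_gt0 eps (- Q j) (Q i).
rewrite rbf_arg_dot in p1; rewrite rbf_arg_dotN in p2.
have nn := mulr_ge0 (n_ge0 i) (n_ge0 j).
have aaE : a i * a j = 1 + n i + n j + n i * n j by rewrite /a; ring.
rewrite gram_w ltr_norml ltr_pdivlMr // ltr_pdivrMr // aaE.
by apply/andP; split; lra.
Qed.

(** The first coordinate is [1 - 1 / a i]; it determines [a i], after which the other coordinates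
    determine [Q i]. *)
Let w_inj : injective w.
Proof.
move=> i j /rowP wij.
have := wij ord0; rewrite !mxE unlift_none /= => nij.
have aij : a i = a j.
  have E k : (a k)^-1 = 1 - n k / a k by rewrite /a; field; rewrite -/(a k) a_neq0.
  by apply: invr_inj; rewrite [LHS]E [RHS]E nij.
apply: injQ; apply/rowP => l; have := wij (lift ord0 l).
rewrite !mxE liftK !mxE aij; apply: mulfI.
by rewrite !mulf_neq0 ?invr_eq0 ?a_neq0 ?gt_eqF // sqrtr_gt0 ltr0n.
Qed.

Let kernel_form_sum0 F b : (forall j, \sum_i b i * F (gram w i j) = 0) ->
  kernel_form w F b = 0.
Proof.
move=> bF; rewrite /kernel_form exchange_big big1 //= => j _.
under eq_bigr do rewrite [b _ * b j]mulrC -mulrA.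
by rewrite -mulr_sumr bF mulr0.
Qed.

Let gramC i j : gram w i j = gram w j i.
Proof. by apply: eq_bigr => l _; rewrite mulrC. Qed.

Let pow_eq0 F b k c : 0 < c ->
  c * kernel_form w (fun z => z ^+ k) b <= kernel_form w F b ->
  kernel_form w F b = 0 -> kernel_form w (fun z => z ^+ k) b = 0.
Proof.
move=> c0 cF F0; apply/eqP; rewrite eq_le kernel_form_pow_ge0 andbT.
by rewrite -(pmulr_rle0 _ c0) -F0.
Qed.

(** All power series coefficients of [(1 - z)^(-1/2)] are positive, so a vanishing form makes every
    power form vanish. *)
Let invsqrt_kernel b :
  (forall j, \sum_i b i * (Num.sqrt (1 - gram w i j))^-1 = 0) ->
  forall i, b i = 0.
Proof.
move=> bF; apply: (kernel_form_strict (w := w)) => // k.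
have [c c0 [N0 cN]] := coef_invsqrt_iter_gt0 R k.
apply: (pow_eq0 c0); last first.
  exact: (kernel_form_sum0 (F := fun z => (Num.sqrt (1 - z))^-1)).
apply: (kernel_form_lim_ge (P := @invsqrt_iter R) (N0 := N0)) => //.
  by move=> N l; exact: coef_invsqrt_iter_ge0.
by move=> i j; exact: invsqrt_iter_cvg.
Qed.

Let H z : R := 1 - Num.sqrt (1 - z).

Let H_form_ge b k : (0 < k)%N -> exists2 c : R, 0 < c &
  c * kernel_form w (fun z => z ^+ k) b <= kernel_form w H b.
Proof.
move=> k0; have [c c0 cN] := coef_sqrt_iter_gt0 R k0; exists c => //.
apply: (kernel_form_lim_ge (P := sqrt_iter R) (N0 := k)) => //.
  by move=> N l; exact: coef_sqrt_iter_ge0.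
by move=> i j; exact: sqrt_iter_cvg.
Qed.

Let sqrt_form b : kernel_form w (fun z => Num.sqrt (1 - z)) b =
  (\sum_i b i) ^+ 2 - kernel_form w H b.
Proof.
rewrite -(kernel_form_pow0 w) /kernel_form -sumrB; apply: eq_bigr => i _.
by rewrite -sumrB; apply: eq_bigr => j _; rewrite /H expr0; ring.
Qed.

(* The form is nonpositive on [sum b = 0], a hyperplane, and positive on the first
   basis vector; a kernel vector off the hyperplane would contradict this. *)
Let sqrt_kernel b : (forall j, \sum_i b i * Num.sqrt (1 - gram w i j) = 0) ->
  forall i, b i = 0.
Proof.
move=> bF i.
have [b0|b0] := eqVneq (\sum_i b i) 0.
  have F0 := kernel_form_sum0 (F := fun z => Num.sqrt (1 - z)) bF.
  have H0 : kernel_form w H b = 0.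
    by move: F0; rewrite sqrt_form b0 expr0n /= sub0r => /eqP; rewrite oppr_eq0 => /eqP.
  apply: (kernel_form_strict (w := w)) => // -[|k].
    by rewrite kernel_form_pow0 b0 expr0n.
  by have [c c0 cH] := @H_form_ge b k.+1 isT; exact: (pow_eq0 c0 cH).
exfalso; set s := \sum_i b i in b0.
pose e j : R := (j == i)%:R.
(* The basis vector [e] moved along the kernel vector [b] into the hyperplane; this leaves the value
   of the form unchanged. *)
pose v j := e j - b j / s.
have v0 : \sum_j v j = 0.
  rewrite sumrB -mulr_suml -/s divff // (bigD1 i) //= big1 ?addr0.
    by rewrite /e eqxx subrr.
  by move=> j /negbTE ji; rewrite /e ji.
have ve : kernel_form w (fun z => Num.sqrt (1 - z)) v =
          Num.sqrt (1 - gram w i i).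
  have E1 j : \sum_k v k * Num.sqrt (1 - gram w k j) = Num.sqrt (1 - gram w i j).
    under eq_bigr do rewrite mulrBl [_ / s]mulrC -mulrA.
    rewrite sumrB -mulr_sumr bF mulr0 subr0 (bigD1 i) //= big1 ?addr0.
      by rewrite /e eqxx mul1r.
    by move=> k /negbTE ki; rewrite /e ki mul0r.
  rewrite /kernel_form exchange_big /=.
  transitivity (\sum_j v j * Num.sqrt (1 - gram w j i)); last by rewrite E1.
  apply: eq_bigr => j _; under eq_bigr do rewrite [v _ * v j]mulrC -mulrA.
  by rewrite -mulr_sumr E1 gramC.
have : 0 < Num.sqrt (1 - gram w i i).
  by rewrite sqrtr_gt0 subr_gt0 (le_lt_trans (ler_norm _)).
rewrite -ve sqrt_form v0 expr0n /= sub0r oppr_gt0 ltNge => /negP; apply.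
have [c c0 cH] := @H_form_ge v 1 isT.
by apply: le_trans cH; rewrite mulr_ge0 ?(ltW c0) // kernel_form_pow_ge0.
Qed.

(** The root of the argument is that of [1 - gram] scaled by the roots of [a]; rescaling a left
    kernel vector accordingly reduces to the two kernels above. *)
Lemma rbf_gram_unitmx kind :
  (\matrix_(h < m, j < m) rbf_at kind eps (Q j) (Q h)) \in unitmx.
Proof.
rewrite unitmxE unitfE; apply/negP => /det0P[v /eqP v0 vG]; apply: v0.
apply/rowP => i; rewrite [RHS]mxE.
have vj j : \sum_i v ord0 i * rbf_at kind eps (Q j) (Q i) = 0.
  by have /rowP/(_ j) := vG; rewrite !mxE; under eq_bigr do rewrite mxE.
have sa_neq0 k : Num.sqrt (a k) != 0 by rewrite gt_eqF // sqrtr_gt0.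
have sE k j : Num.sqrt (rbf_arg eps (Q j) (Q k)) =
    Num.sqrt (a k) * Num.sqrt (a j) * Num.sqrt (1 - gram w k j).
  by rewrite rbf_arg_gram !sqrtrM ?mulr_ge0 // ltW.
case: kind {vG} vj => vj.
  pose b k := v ord0 k * Num.sqrt (a k).
  have : b i = 0.
    apply: sqrt_kernel => j; apply: (mulfI (sa_neq0 j)).
    rewrite mulr0 -[RHS](vj j) mulr_sumr; apply: eq_bigr => k _.
    by rewrite rbf_atE sE /b; ring.
  by move=> /eqP; rewrite mulf_eq0 (negbTE (sa_neq0 i)) orbF => /eqP.
pose b k := v ord0 k / Num.sqrt (a k).
have : b i = 0.
  apply: invsqrt_kernel => j; apply: (mulfI (invr_neq0 (sa_neq0 j))).
  rewrite mulr0 -[RHS](vj j) mulr_sumr; apply: eq_bigr => k _.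
  by rewrite rbf_atE sE /b !invfM; ring.
by move=> /eqP; rewrite mulf_eq0 invr_eq0 (negbTE (sa_neq0 i)) orbF => /eqP.
Qed.

End rbf_gram.

(** * Almost sure nonsingularity *)

Lemma kansa_seq0_unitmx (R : realType) (d : nat) kind (eps : R) m
    (Q : 'I_m -> 'rV[R]_d) s :
  0 < eps -> injective Q -> kansa_seq kind eps Q 0 s \in unitmx.
Proof.
move=> e0 injQ; rewrite /kansa_seq /kansa_matrix unitmxE.
rewrite [X in block_mx _ _ X _]thinmx0 det_ublock det_mx00 mul1r -unitmxE.
exact: rbf_gram_unitmx.
Qed.

(** Reordering the points multiplies the matrix on both sides by block permutation matrices. It
    serves to undo the reversal that arises when points are prepended one by one. *)
Lemma kansa_matrix_perm_unitmx (R : realType) (d : nat) kind (eps : R) m n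
    (P : 'I_n -> 'rV[R]_d) (Q : 'I_m -> 'rV[R]_d) (p : 'S_n) :
  kansa_matrix kind eps P Q \in unitmx ->
  kansa_matrix kind eps (P \o p) Q \in unitmx.
Proof.
move=> uK.
pose U (s : 'S_n) : 'M[R]_(n + m) := block_mx (perm_mx s) 0 0 1%:M.
have uU s : U s \in unitmx.
  by rewrite unitmxE det_ublock det_perm det1 mulr1 unitrX // unitrN1.
have -> : kansa_matrix kind eps (P \o p) Q =
    U p *m kansa_matrix kind eps P Q *m U p^-1%g.
  rewrite /U /kansa_matrix !mulmx_block.
  rewrite !mul0mx !mulmx0 !mul1mx !mulmx1 !addr0 !add0r -!row_permE -!col_permE.
  by congr block_mx; apply/matrixP => i j; rewrite !mxE.
by rewrite !unitmx_mul !uU uK.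
Qed.

(** * Measurability of the determinant *)

Section kansa_measurable.
Context (R : realType) (d : nat) (kind : rbf_kind) (eps : R).
Context (d' : measure_display) (T : measurableType d').

Let measurable_rbf_arg (f g : T -> 'rV[R]_d) : measurable_fun setT f ->
  measurable_fun setT g -> measurable_fun setT (fun t => rbf_arg eps (f t) (g t)).
Proof.
move=> mf mg; rewrite /rbf_arg.
apply: measurable_funD; first exact: measurable_cst.
apply: measurable_funM; first exact: measurable_cst.
apply: measurable_sum => l; apply: measurable_funX.
by apply: measurable_funB; apply: measurableT_comp (measurable_rV_coord l) _.
Qed.

Let measurable_radial (p : {poly R}) (f g : T -> 'rV[R]_d) :
  measurable_fun setT f -> measurable_fun setT g ->
  measurable_fun setT (fun t => let s := rbf_arg eps (f t) (g t) in
    p.[s] * Num.sqrt s / s ^+ 3).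
Proof.
move=> mf mg; have ms := measurable_rbf_arg mf mg.
(* The inverse is written as a real power, a measurable function that agrees with it as the argument
   is positive. *)
have -> : (fun t => let s := rbf_arg eps (f t) (g t) in
      p.[s] * Num.sqrt s / s ^+ 3) =
    (fun t => p.[rbf_arg eps (f t) (g t)] * Num.sqrt (rbf_arg eps (f t) (g t)) *
      (rbf_arg eps (f t) (g t) `^ (- 1)) ^+ 3).
  by apply/funext => t /=; rewrite powR_inv1 ?exprVn // ltW // rbf_arg_gt0.
apply: measurable_funM.
  apply: measurable_funM.
    apply: (@measurableT_comp _ _ _ _ _ _ (horner p)) ms.
    exact: measurable_poly.
  apply: (@measurableT_comp _ _ _ _ _ _ (fun t : R => Num.sqrt t)) ms.
  apply: continuous_measurable_fun; exact: sqrt_continuous.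
apply: measurable_funX.
apply: (@measurableT_comp _ _ _ _ _ _ (fun t : R => t `^ (- 1))) ms.
exact: measurable_powR.
Qed.

Lemma measurable_kansa_det m n (P : 'I_n -> T -> 'rV[R]_d) (Q : 'I_m -> 'rV[R]_d) :
  (forall i, measurable_fun setT (P i)) ->
  measurable_fun setT (fun t => \det (kansa_matrix kind eps (P^~ t) Q)).
Proof.
move=> mP; rewrite /determinant.
have mQ h : measurable_fun [set: T] (fun=> Q h) by exact: measurable_cst.
apply: measurable_sum => s; apply: measurable_funM; first exact: measurable_cst.
apply: measurable_prod => i _.
under eq_fun do rewrite kansa_matrixE /kansa_center.
case: fintype.split => a; case: fintype.split => b.
- by under eq_fun do rewrite laplacian_rbf_at; exact: measurable_radial.
- by under eq_fun do rewrite laplacian_rbf_at; exact: measurable_radial.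
- by under eq_fun do rewrite rbf_at_val; exact: measurable_radial.
- by under eq_fun do rewrite rbf_at_val; exact: measurable_radial.
Qed.

End kansa_measurable.

(** Fubini one point at a time, from any nonsingular start [s]: [catrev] moves the head of the tuple
    onto [s] first, matching the order in which [iid_law] splits off points. *)
Lemma kansa_iid_null (R : realType) (d : nat) kind (eps : R) m
    (Q : 'I_m -> 'rV[R]_d) (mu : set 'rV[R]_d -> \bar R) n l s :
  (0 < d)%N -> 0 < eps ->
  (forall N, null_for (@lebesgue_rV R d) N -> null_for mu N) ->
  kansa_seq kind eps Q l s \in unitmx ->
  null_for (@iid_law R d mu n)
    [set t : n.-tuple 'rV[R]_d |
       kansa_seq kind eps Q (n + l) (catrev t s) \notin unitmx].
Proof.
move=> d0 e0 muN; elim: n => [|n IH] in l s *; move=> uK.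
  move=> B mB BS; rewrite /= diracE memNset // => /BS /=.
  by rewrite uK.
apply: iid_law_null_cons (muN _ (kansa_bordering_null d0 e0 uK)) _ => x /= /negP.
by rewrite negbK => /IH; rewrite addSnnS.
Qed.

Unset Implicit Arguments.

Theorem theorem1 (R : realType) (d : nat) (Omega : set 'rV[R]_d)
  (eps : R) (k : rbf_kind) (m : nat) (Q : 'I_m -> 'rV[R]_d)
  (sigma : 'rV[R]_d -> R) (n : nat) :
  (1 <= d)%N ->
  open Omega -> connected Omega -> Omega !=set0 -> bounded_set Omega ->
  0 < eps ->
  (1 <= m)%N ->
  injective Q -> (forall h, boundary_of Omega (Q h)) ->
  measurable_fun Omega sigma ->
  (forall x, Omega x -> 0 <= sigma x) ->
  (\int[@lebesgue_rV R d]_(x in Omega) (sigma x)%:E = 1)%E ->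
  (@iid_law R d (density_law Omega sigma) n).-negligible
    [set P : n.-tuple 'rV[R]_d |
       kansa_matrix k eps (fun i => tnth P i) Q \notin unitmx].
Proof.
move=> d0 _ _ _ _ e0 _ injQ _ _ _ _.
apply: null_for_negligible.
  have mdet := @measurable_kansa_det R d k eps _ (n.-tuple 'rV[R]_d) m n
    (fun i t => tnth t i) Q (fun i => @measurable_tnth _ _ _ i).
  rewrite (_ : [set P | _] = setT `&` (fun P : n.-tuple 'rV[R]_d =>
      \det (kansa_matrix k eps (fun i => tnth P i) Q)) @^-1` [set 0]).
    exact: mdet.
  by rewrite setTI; apply/seteqP; split => P /=;
    rewrite unitmxE unitfE negbK => /eqP.
have H := @kansa_iid_null R d k eps m Q (density_law Omega sigma) n 0 [::] d0 e0
  (fun N => @density_law_null _ _ _ _ N) (kansa_seq0_unitmx k [::] e0 injQ).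
move=> B mB BS; apply: H => // t Bt /=; rewrite addn0.
(* With an empty start [catrev] gives the reversed tuple; the permutation [rev_ord] restores the
   order. *)
apply: contra (BS t Bt) => /= /(kansa_matrix_perm_unitmx (perm (@rev_ord_inj n))).
congr (_ \in unitmx); congr (kansa_matrix k eps _ Q).
apply/funext => i /=; rewrite permE (tnth_nth 0) -/(rev t) nth_rev ?size_tuple /=.
  by rewrite subnSK // subKn // ltnW.
exact: ltn_ord (rev_ord i).
Qed.
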